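(* Let $W_n^{0,\rm G}(x_1,\dots,x_n;N)$ be the leading low temperature coefficient of the $n$-point function of the Gaussian $\beta$-ensemble with weight $e^{-\beta x^2/2}$, and $W_n^{0,\rm G^*}(x_1,\dots,x_n;\alpha)$ the scaled high temperature limit of the $n$-point function of the Gaussian $\beta$-ensemble with weight $e^{-x^2/2}$, with respective expansion coefficients $\mu^{0,\rm G}_{p_1,\dots,p_n}(N)$ and $\mu^{0,\rm G^*}_{p_1,\dots,p_n}(\alpha)$. Then for every $n\ge1$ $$-\Big(\frac{-i}{\sqrt2}\Big)^n\frac1N\,W_n^{0,\rm G}\big(ix_1/\sqrt2,\dots,ix_n/\sqrt2;N\big)=W_n^{0,\rm G^*}(x_1,\dots,x_n;-N).$$ Equivalently, for all nonnegative integers $p_1,\dots,p_n$, $$(-1)^{n+1}\,\frac{(-i\sqrt2)^{p_1+\cdots+p_n}}{N}\,\mu^{0,\rm G}_{p_1,\dots,p_n}(N)=\mu^{0,\rm G^*}_{p_1,\dots,p_n}(-N).$$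
   Context: For a weight $w$ and $\kappa=\beta/2>0$, consider the density on $\mathbb R^N$ proportional to $\prod_{l=1}^N w(\lambda_l)\prod_{1\le j<k\le N}|\lambda_k-\lambda_j|^{2\kappa}$. Let $\mu_{p_1,\dots,p_n}(N,\kappa)$ be the mixed (joint) cumulant of $\sum_j\lambda_j^{p_1},\dots,\sum_j\lambda_j^{p_n}$ (for $n=1$, the moment $\langle\sum_j\lambda_j^{p_1}\rangle$), and define the formal series $$\overline W_n(x_1,\dots,x_n;N,\kappa)=\frac1{x_1\cdots x_n}\sum_{p_1,\dots,p_n\ge0}\frac{\mu_{p_1,\dots,p_n}(N,\kappa)}{x_1^{p_1}\cdots x_n^{p_n}}.$$ Write $\overline W_n^{\rm G}$ for weight $w(x)=e^{-\kappa x^2}$ $(=e^{-\beta x^2/2})$ and $\overline W_n^{\rm G^*}$ for weight $w(x)=e^{-x^2/2}$. The quantities in the claim are defined (coefficientwise) by the leading terms $$\overline W_n^{\rm G}(x_1,\dots,x_n;N,\kappa)=\frac1{\kappa^{n-1}}W_n^{0,\rm G}(x_1,\dots,x_n;N)+\cdots\quad(\kappa\to\infty,\ N\text{ fixed}),$$ $$\frac1N\overline W_n^{\rm G^*}(x_1,\dots,x_n;N,\kappa)\Big|_{\kappa=\alpha/N}=W_n^{0,\rm G^*}(x_1,\dots,x_n;\alpha)+\cdots\quad(N\to\infty,\ \alpha\text{ fixed}),$$ with expansions $$W_n^{0,\rm G}(x_1,\dots,x_n;N)=\frac1{x_1\cdots x_n}\sum_{p_1,\dots,p_n\ge0}\frac{\mu^{0,\rm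 G}_{p_1,\dots,p_n}(N)}{x_1^{p_1}\cdots x_n^{p_n}},\qquad W_n^{0,\rm G^*}(x_1,\dots,x_n;\alpha)=\frac1{x_1\cdots x_n}\sum_{p_1,\dots,p_n\ge0}\frac{\mu^{0,\rm G^*}_{p_1,\dots,p_n}(\alpha)}{x_1^{p_1}\cdots x_n^{p_n}}.$$ The coefficients are polynomials in $N$, respectively $\alpha$, and are extended by polynomiality, so that evaluation at $\alpha=-N$ makes sense. Identities are between formal series. *)

(* Defs.v *)
From HB Require Import structures.
From mathcomp Require Import all_boot all_order all_algebra.
From mathcomp Require Import complex.
From mathcomp Require Import all_classical all_reals all_analysis.

Set Implicit Arguments.
Unset Strict Implicit.
Unset Printing Implicit Defensive.

Import Order.TTheory GRing.Theory Num.Theory.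
Import numFieldTopology.Exports numFieldNormedType.Exports.

Local Open Scope classical_set_scope.
Local Open Scope ring_scope.

(* Product measures of sigma-finite measures are sigma-finite. The library
   proves this, but its canonical instance is shadowed by the one for products
   of subprobabilities and is not found by inference. *)
Lemma product_sigma_finite d1 d2 (T1 : measurableType d1)
    (T2 : measurableType d2) (R : realType)
    (m1 : {sigma_finite_measure set T1 -> \bar R})
    (m2 : {sigma_finite_measure set T2 -> \bar R}) :
  sigma_finite setT (m1 \x m2)%E.
Proof.
have /sigma_finiteP[F [TF ndF Foo]] := sigma_finiteT m1.
have /sigma_finiteP[G [TG ndG Goo]] := sigma_finiteT m2.
exists (fun n => F n `*` G n).
  rewrite -setXTT TF TG predeqE => -[x y]; split.
    move=> [/= [n _ Fnx] [k _ Gky]]; exists (maxn n k) => //; split.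
    - by move: x Fnx; exact/subsetPset/ndF/leq_maxl.
    - by move: y Gky; exact/subsetPset/ndG/leq_maxr.
  by move=> [n _ []/= ? ?]; split; exists n.
move=> k; have [? ?] := Foo k; have [? ?] := Goo k.
split; first exact: measurableX.
by rewrite product_measure1E// lte_mul_pinfty// ge0_fin_numE.
Qed.

Section LebesgueTuple.
Context {R : realType}.
Local Notation TR := (measurableTypeR R).

Definition tuple_cons n (v : TR * n.-tuple TR) : n.+1.-tuple TR :=
  [tuple of v.1 :: v.2].

Definition tuple_uncons n (t : n.+1.-tuple TR) : TR * n.-tuple TR :=
  (thead t, [tuple of behead t]).

Lemma measurable_tuple_cons n : measurable_fun setT (@tuple_cons n).
Proof. by apply: measurable_cons; [exact: measurable_fst|exact: measurable_snd]. Qed.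

Lemma measurable_tuple_uncons n : measurable_fun setT (@tuple_uncons n).
Proof.
apply: measurable_fun_pair; last exact: measurable_behead.
by apply: measurable_tnth.
Qed.

Lemma tuple_consK n : cancel (@tuple_cons n) (@tuple_uncons n).
Proof.
by case=> x t; rewrite /tuple_uncons/= theadE; congr pair; apply: val_inj.
Qed.

Lemma tuple_unconsK n : cancel (@tuple_uncons n) (@tuple_cons n).
Proof. by move=> t; rewrite [RHS]tuple_eta. Qed.

Section Step.
Context n (m : {sigma_finite_measure set (n.-tuple TR) -> \bar R}).

Definition lebesgue_cons : set (n.+1.-tuple TR) -> \bar R :=
  pushforward (@lebesgue_measure R \x m)%E (@tuple_cons n).

Let mcons := @isMeasurableFun.Build _ _ _ _ _ (@measurable_tuple_cons n).
Let pcons : {mfun _ >-> _} := HB.pack (@tuple_cons n) mcons.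

Let lebesgue_cons0 : lebesgue_cons set0 = 0%E.
Proof. by rewrite /lebesgue_cons /pushforward preimage_set0 measure0. Qed.

Let lebesgue_cons_ge0 A : (0 <= lebesgue_cons A)%E.
Proof. exact: (@measure_ge0 _ _ _ (pushforward (@lebesgue_measure R \x m)%E pcons)). Qed.

Let lebesgue_cons_sigma_additive : semi_sigma_additive lebesgue_cons.
Proof.
have := @measure_semi_sigma_additive _ _ _
  (pushforward (@lebesgue_measure R \x m)%E pcons).
exact.
Qed.

HB.instance Definition _ := isMeasure.Build _ _ _ lebesgue_cons
  lebesgue_cons0 lebesgue_cons_ge0 lebesgue_cons_sigma_additive.

Let lebesgue_cons_sigma_finite : sigma_finite setT lebesgue_cons.
Proof.
have [F FT Ffin] := product_sigma_finite (@lebesgue_measure R) m.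
exists (fun i => @tuple_uncons n @^-1` F i).
  by rewrite -preimage_bigcup -FT preimage_setT.
move=> i; have [mF Foo] := Ffin i; split.
  by rewrite -[X in measurable X]setTI; exact: measurable_tuple_uncons.
rewrite /lebesgue_cons /pushforward -comp_preimage.
rewrite (_ : _ \o _ = id); last by apply/funext => v /=; rewrite tuple_consK.
by rewrite preimage_id.
Qed.

HB.instance Definition _ := Measure_isSigmaFinite.Build _ _ _ lebesgue_cons
  lebesgue_cons_sigma_finite.

End Step.

Fixpoint lebesgue_tuple (N : nat) :
    {sigma_finite_measure set (N.-tuple TR) -> \bar R} :=
  match N with
  | 0 => dirac [tuple]
  | N'.+1 => lebesgue_cons (lebesgue_tuple N')
  end.

End LebesgueTuple.

Section BetaEnsemble.
Context {R : realType}.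
Implicit Types (w : R -> R) (kappa : R) (N n : nat).

(* Unnormalised density; [`^] is the real power, and 2 * kappa = beta. *)
Definition ensemble_weight w kappa N (lambda : N.-tuple (measurableTypeR R)) : R :=
  \prod_(l < N) w (tnth lambda l) *
  \prod_(j < N) \prod_(k < N | (j < k)%N)
    `|tnth lambda k - tnth lambda j| `^ (2 * kappa).

Definition ensemble_mean w kappa N
    (f : N.-tuple (measurableTypeR R) -> R) : R :=
  (\int[lebesgue_tuple N]_lambda (f lambda * ensemble_weight w kappa lambda)) /
  (\int[lebesgue_tuple N]_lambda ensemble_weight w kappa lambda).

(* Moment-cumulant formula, summed over the set partitions P of the n indices;
   for n = 1 it is the mean of X. *)
Definition joint_cumulant (T : Type) (E : (T -> R) -> R) n
    (X : 'I_n -> T -> R) : R :=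
  \sum_(P : {set {set 'I_n}} | finset.partition P (finset.setTfor 'I_n))
    (-1) ^+ #|P|.-1 * (#|P|.-1)`!%:R *
    \prod_(B in P) E (fun t => \prod_(i in B) X i t).

Definition mixed_cumulant w kappa N n (p : 'I_n -> nat) : R :=
  joint_cumulant (@ensemble_mean w kappa N)
    (fun i lambda => \sum_(l < N) tnth lambda l ^+ p i).

Definition mu0G n N (p : 'I_n -> nat) : R :=
  lim (kappa ^+ n.-1 *
         mixed_cumulant (fun x => expR (- kappa * x ^+ 2)) kappa N p
       @[kappa --> +oo]).

(* The high temperature limit is only available for alpha > 0, where it is a
   polynomial in alpha. That polynomial is unique, having prescribed values at
   all alpha > 0; it is what is evaluated at negative alpha. *)
Definition mu0Gs n (p : 'I_n -> nat) : {poly R} :=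
  xget 0 [set Q : {poly R} | forall alpha : R, 0 < alpha ->
    N%:R^-1 *
      mixed_cumulant (fun x => expR (- x ^+ 2 / 2)) (alpha / N%:R) N p
      @[N --> \oo] --> Q.[alpha]].

(* Formal series in x_1^{+-1}, ..., x_n^{+-1}: f e is the coefficient of
   x_1^(e 1) ... x_n^(e n). *)
Definition fseries n := ('I_n -> int) -> R[i].

(* (x_1 ... x_n)^-1 * \sum_p mu_p x_1^(- p_1) ... x_n^(- p_n); the monomial with
   exponents e < 0 has index p = - e - 1. *)
Definition npoint_series n (mu : ('I_n -> nat) -> R) : fseries n :=
  fun e => if [forall j, (e j < 0)%R]
           then (mu (fun j => absz (e j + 1)%R))%:C%C else 0.

Definition series_scale n (c : R[i]) (f : fseries n) : fseries n :=
  fun e => c * f e.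

(* f (c x_1, ..., c x_n), for c != 0 *)
Definition series_dilate n (c : R[i]) (f : fseries n) : fseries n :=
  fun e => c ^ (\sum_j e j) * f e.

Definition W0G n N : fseries n := npoint_series (@mu0G n N).

Definition W0Gs n (alpha : R) : fseries n :=
  npoint_series (fun p => (mu0Gs p).[alpha]).

End BetaEnsemble.

(* Main.v *)
Require Import Defs.
From mathcomp Require Import all_boot all_order all_algebra.
From mathcomp Require Import boolp complex ring lra zify.

(* Integrating the divergence of the vector fields
   lambda_j^k * prod_i (sum_l lambda_l^(p_i)) d/dlambda_j against the density
   gives linear recursions ("loop equations") for the mixed moments of power
   sums. The singular factor |u|^(2 kappa) is first replaced by
   (u^2 + eps)^kappa; the terms that would be singular in the limit combine
   into divided differences, and dominated convergence gives eps -> 0.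

   A symmetric family of moments is encoded as a function on lists of exponents.
   The shuffle product of such functions is the product of exponential
   generating series, and prepending an exponent is a derivation; cumulants are
   the logarithm of the moments, so dividing the moment recursion by the moments
   yields a quadratic recursion which determines all cumulants by induction on
   the total degree.

   After rescaling, its coefficients are polynomial in 1/kappa (resp. in 1/N
   when kappa = alpha/N), so both limits exist and amount to evaluation at 0.
   The two limiting recursions are exchanged by the substitution
   F(p) |-> -(-1)^n (-i sqrt 2)^|p| F(p) / N together with alpha = -N. *)

Set Implicit Arguments.
Unset Strict Implicit.
Unset Printing Implicit Defensive.

Import Order.TTheory GRing.Theory Num.Theory.

Local Open Scope ring_scope.

(** * Shuffle algebra and the cumulant recursion *)

(** The high temperature regime sends [kappa] to 0, so integration by parts is needed for every
    [kappa > 0], whereas for [kappa < 1/2] the derivative of |u|^(2 kappa) is unbounded near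
    coincident points. This forces the regularization.

    At finite temperature the term with a longer list of exponents and the product of two cumulants
    carry the same coefficient. Rescaling separates them, since one has an additional entry and the
    other an additional factor: both limits kill the former and keep the latter. The two limiting
    recursions thus have the same shape, and only their constants remain to be matched. Every term
    loses two units of degree, so a dilation enters through its square; the one-point coefficient
    tends to -1/2 at low temperature and to 1 at high temperature, and this change of sign is what
    makes the dilation imaginary. *)

Section Shuffle.
Variables (T : Type) (K : comNzRingType).
Implicit Types (f g h : seq T -> K) (s u : seq T).

Definition deriv_head (x : T) f : seq T -> K := fun s => f (x :: s).

(** The Leibniz rule serves as the definition. Unfolded, it is the sum of [f u * g v] over all ways
    to distribute [s] into complementary subsequences [u] and [v]. *)
Fixpoint shuffle f g s : K :=
  if s is x :: s' then
    shuffle (deriv_head x f) g s' + shuffle f (deriv_head x g) s'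
  else f [::] * g [::].

Lemma shuffleC f g : shuffle f g =1 shuffle g f.
Proof.
move=> s; elim: s f g => [|x s IH] f g /=; first by rewrite mulrC.
by rewrite IH addrC IH.
Qed.

Lemma shuffleDl f g h s :
  shuffle (fun u => f u + g u) h s = shuffle f h s + shuffle g h s.
Proof.
elim: s f g h => [|x s IH] f g h /=; first by rewrite mulrDl.
rewrite (IH f g) [X in X + _](IH (deriv_head x f) (deriv_head x g)).
by rewrite addrACA.
Qed.

Lemma shuffleZl c f h s : shuffle (fun u => c * f u) h s = c * shuffle f h s.
Proof.
elim: s f h => [|x s IH] f h /=; first by rewrite mulrA.
by rewrite IH [X in X + _](IH (deriv_head x f)) mulrDr.
Qed.

Lemma shuffle_suml (I : Type) (r : seq I) (F : I -> seq T -> K) h s :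
  shuffle (fun u => \sum_(i <- r) F i u) h s = \sum_(i <- r) shuffle (F i) h s.
Proof.
elim: r => [|i r IH].
  under [X in shuffle X]funext do rewrite big_nil -(mul0r 0).
  by rewrite shuffleZl mul0r big_nil.
under [X in shuffle X]funext do rewrite big_cons.
by rewrite shuffleDl IH big_cons.
Qed.

Lemma deriv_shuffle x f g :
  deriv_head x (shuffle f g) =
  (fun s => shuffle (deriv_head x f) g s + shuffle f (deriv_head x g) s).
Proof. by []. Qed.

Lemma shuffleA f g h : shuffle f (shuffle g h) =1 shuffle (shuffle f g) h.
Proof.
move=> s; elim: s f g h => [|x s IH] f g h /=; first by rewrite mulrA.
rewrite IH !deriv_shuffle shuffleDl (shuffleC f) shuffleDl.
by rewrite !(shuffleC _ f) !IH addrA.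
Qed.

Definition shuffle1 s : K := if s is [::] then 1 else 0.

Lemma shuffle0l g s : shuffle (fun=> 0) g s = 0.
Proof. by elim: s g => [|x s IH] g /=; rewrite ?mul0r // !IH addr0. Qed.

Lemma shuffle1l g : shuffle shuffle1 g =1 g.
Proof.
move=> s; elim: s g => [|x s IH] g /=; first by rewrite mul1r.
by rewrite IH shuffle0l add0r.
Qed.

Lemma shuffle_leading s f g :
  (forall u, (size u < size s)%N -> f u = 0) -> shuffle f g s = f s * g [::].
Proof.
elim: s f g => [//|x s IH] f g f0 /=.
rewrite IH => [|u us]; last exact: f0.
rewrite IH => [|u us]; last by apply: f0; exact: ltnW.
by rewrite f0 // mul0r addr0.
Qed.

(** A series with constant term 1 can be cancelled: on a shortest list where [f] and [g] might
    differ, [shuffle_leading] reduces the product of [f - g] with [m] to that difference. *)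
Lemma shuffleIl m f g : m [::] = 1 ->
  shuffle f m =1 shuffle g m -> f =1 g.
Proof.
move=> m1 fg s; apply/eqP; rewrite -subr_eq0.
have [n] := ubnP (size s); elim: n s => // n IH s; rewrite ltnS => sn.
have := @shuffle_leading s (fun u => f u - g u) m.
rewrite m1 mulr1 => <-; last by move=> u us; apply/eqP/IH/(leq_trans us).
under [X in shuffle X]funext do rewrite -mulN1r.
by rewrite shuffleDl shuffleZl fg mulN1r subrr.
Qed.

End Shuffle.

(** * Loop recursions: uniqueness, existence, rescaling *)

Section LoopRecursion.
Variable K : comNzRingType.
Implicit Types (F G : seq nat -> K) (s : seq nat) (g : nat -> seq nat -> K).

(* The sum, over the entries y of s, of y * g (k + y - 1) (s without y). *)
Fixpoint absorb (k : nat) g s : K :=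
  if s is y :: s' then
    y%:R * g (k + y).-1 s' + absorb k (fun x u => g x (y :: u)) s'
  else 0.

Lemma absorbD k g g' s :
  absorb k (fun x u => g x u + g' x u) s = absorb k g s + absorb k g' s.
Proof.
elim: s g g' => [|y s IH] g g' /=; first by rewrite addr0.
by rewrite IH mulrDr addrACA.
Qed.

Lemma absorb_shuffle k g h s :
  absorb k (fun x => shuffle (g x) h) s = shuffle (absorb k g) h s.
Proof.
elim: s g h => [|y s IH] g h /=; first by rewrite mul0r.
rewrite absorbD !IH addrA; congr (_ + _).
by rewrite -shuffleZl -shuffleDl.
Qed.

Lemma eq_absorb k g g' s :
  (forall x u, (x + sumn u < k + sumn s)%N -> g x u = g' x u) ->
  absorb k g s = absorb k g' s.
Proof.
elim: s g g' => [//|y s IH] g g' gg' /=; congr (_ + _).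
  (* For [y = 0] the truncated predecessor could break the strict bound on the degree, but the
     coefficient [y] kills that term. *)
  case: y gg' => [|y] gg'; first by rewrite !mul0r.
  by congr (_ * _); apply: gg' => /=; lia.
apply: IH => x u xu; apply: gg' => /=; lia.
Qed.

Lemma eq_shuffle F F' G G' s :
  (forall u, (sumn u <= sumn s)%N -> F u = F' u) ->
  (forall u, (sumn u <= sumn s)%N -> G u = G' u) ->
  shuffle F G s = shuffle F' G' s.
Proof.
elim: s F F' G G' => [|x s IH] F F' G G' FF GG /=; first by rewrite FF // GG.
congr (_ + _); apply: IH => u us; [apply: FF|apply: GG|apply: FF|apply: GG];
  rewrite /= ?leq_add2l //; lia.
Qed.

(** [u] weighs the one-point term, [v] the term with one more exponent, [w] the product of two
    values, [r] the merging with another exponent. [v] and [w] coincide for the ensemble but scale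
    differently. A head 0 is a base case: the power sum of exponent 0 is constant, and a joint
    cumulant of several variables, one of them constant, vanishes. *)
Definition loop_step (u v w r nu : K) F s : K :=
  match s with
  | [::] => 0
  | [:: 0%N] => nu
  | 0%N :: _ => 0
  | k.+1 :: s' =>
    u * k%:R * F (k.-1 :: s') +
    \sum_(i < k) (v * F [:: (k.-1 - i)%N, (i : nat) & s'] +
                  w * shuffle (deriv_head (k.-1 - i)%N F) (deriv_head (i : nat) F) s') +
    r * absorb k (fun x => deriv_head x F) s'
  end.

(** The empty list is left free: no right-hand side reads it, and [seq_cumulant] is 1 there, whereas
    a logarithm would give 0. *)
Definition solves_loop u v w r nu F :=
  forall x s, F (x :: s) = loop_step u v w r nu F (x :: s).

Lemma eq_loop_step u v w r nu F G s :
  (forall x t, (x + sumn t < sumn s)%N -> F (x :: t) = G (x :: t)) ->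
  loop_step u v w r nu F s = loop_step u v w r nu G s.
Proof.
case: s => [//|[|k] s] FG //; rewrite /loop_step; congr (_ + _ + _).
- case: k FG => [|k] FG; first by rewrite !mulr0 !mul0r.
  congr (_ * _); apply: FG => /=; lia.
- apply: eq_bigr => i _; congr (_ * _ + _ * _).
    apply: FG => /=; have := ltn_ord i; lia.
  apply: eq_shuffle => t ts; apply: FG => /=; have := ltn_ord i; lia.
- congr (_ * _); apply: eq_absorb => x t xt; apply: FG => /=; lia.
Qed.

Lemma loop_unique u v w r nu F G :
  solves_loop u v w r nu F -> solves_loop u v w r nu G ->
  forall x s, F (x :: s) = G (x :: s).
Proof.
move=> hF hG x s; have [n] := ubnP (x + sumn s)%N.
elim: n x s => // n IH x s; rewrite ltnS => xs.
rewrite hF hG; apply: eq_loop_step => y t yt; apply: IH.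
exact: leq_trans yt xs.
Qed.

Fixpoint loop_iter u v w r nu n : seq nat -> K :=
  if n is n'.+1 then loop_step u v w r nu (loop_iter u v w r nu n')
  else fun=> 0.

(** Fuel [(sumn s).+1] suffices because each step lowers the degree. An explicit solution is needed
    over polynomial rings, where no family of cumulants is at hand to provide one. *)
Definition loop_sol u v w r nu s : K := loop_iter u v w r nu (sumn s).+1 s.

Lemma loop_iter_stable u v w r nu n m s : (sumn s < n)%N -> (sumn s < m)%N ->
  loop_iter u v w r nu n s = loop_iter u v w r nu m s.
Proof.
elim: n m s => // n IH [//|m] s; rewrite !ltnS => sn sm /=.
apply: eq_loop_step => x t xt; apply: IH => /=; lia.
Qed.

Lemma loop_sol_solves u v w r nu :
  solves_loop u v w r nu (loop_sol u v w r nu).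
Proof.
move=> x s.
rewrite -[LHS]/(loop_step u v w r nu (loop_iter u v w r nu (sumn (x :: s))) (x :: s)).
by apply: eq_loop_step => y t yt; apply: loop_iter_stable.
Qed.

(* Dividing the loop equation for moments by the moment series turns it into one
   for cumulants: [deriv_head x C] is [deriv_head x M / M] in the shuffle
   algebra, which is how a logarithm is differentiated. *)
Lemma cumulant_loop (u v r nu : K) (M C : seq nat -> K) :
  M [::] = 1 -> (forall s, M (0%N :: s) = nu * M s) ->
  (forall k s, M (k.+1 :: s) = u * k%:R * M (k.-1 :: s) +
     \sum_(i < k) v * M [:: (k.-1 - i)%N, (i : nat) & s] +
     r * absorb k (fun x => deriv_head x M) s) ->
  (forall x, deriv_head x M =1 shuffle (deriv_head x C) M) ->
  solves_loop u v v r nu C.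
Proof.
move=> M1 M0 ML MC.
have E0 : deriv_head 0%N C =1 (fun s => nu * @shuffle1 nat K s).
  apply: (shuffleIl M1) => s.
  by rewrite -MC shuffleZl shuffle1l; exact: M0.
case=> [s|k]; first by rewrite [LHS]E0; case: s => [|y s] /=; rewrite ?mulr1 ?mulr0.
apply: (shuffleIl M1) => s; rewrite -[LHS]MC /deriv_head ML /=.
rewrite !shuffleDl shuffleZl shuffle_suml shuffleZl.
congr (_ + _ + _).
- by rewrite -MC.
(* A second derivative of M divided by M is C_ab + C_a C_b; this is where the quadratic term arises,
   with the same coefficient as the linear one. *)
- apply: eq_bigr => i _; rewrite shuffleDl !shuffleZl -mulrDr; congr (_ * _).
  set a := (_ - _)%N; set b := nat_of_ord i.
  have -> : M [:: a, b & s] = deriv_head a M (b :: s) by [].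
  rewrite MC /= -shuffleA; congr (_ + _).
  by congr (shuffle _ _ s); apply/funext => t; rewrite MC.
- rewrite -absorb_shuffle; congr (_ * _).
  by apply: eq_absorb => x t _; rewrite MC.
Qed.


Lemma shuffle_scale (sigma tau rho t : K) F G s :
  shuffle (fun u => sigma * rho ^+ size u * t ^+ sumn u * F u)
          (fun u => tau * rho ^+ size u * t ^+ sumn u * G u) s =
  sigma * tau * rho ^+ size s * t ^+ sumn s * shuffle F G s.
Proof.
elim: s F G sigma tau => [|x s IH] F G sigma tau /=; first by rewrite !expr0; ring.
have E a H : deriv_head x (fun u => a * rho ^+ size u * t ^+ sumn u * H u) =
    (fun u => (a * rho * t ^+ x) * rho ^+ size u * t ^+ sumn u * deriv_head x H u).
  by apply/funext => u; rewrite /deriv_head /= exprS exprD; ring.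
by rewrite !E !IH exprS exprD; ring.
Qed.

(** Absorption removes one entry of [s] and one unit of degree; the factors [rho] and [t] restore
    them, which avoids subtracting exponents. *)
Lemma absorb_scale (sigma rho t : K) k F s :
  t * absorb k (fun x u => sigma * rho ^+ size u * t ^+ (x + sumn u) * F (x :: u)) s * rho =
  sigma * rho ^+ size s * t ^+ (k + sumn s) * absorb k (fun x => deriv_head x F) s.
Proof.
have E g : t * absorb k (fun x u => sigma * rho ^+ size u * t ^+ (x + sumn u) * g x u) s * rho =
  sigma * rho ^+ size s * t ^+ (k + sumn s) * absorb k g s; last exact: E.
elim: s sigma g => [|y s IH] sigma g /=; first by rewrite !(mulr0, mul0r).
have {}IH := IH (sigma * rho * t ^+ y) (fun x u => g x (y :: u)).
have -> : (fun x u => sigma * rho ^+ (size u).+1 * t ^+ (x + (y + sumn u)) * g x (y :: u)) =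
  (fun x u => sigma * rho * t ^+ y * rho ^+ size u * t ^+ (x + sumn u) * g x (y :: u)).
  by apply/funext => x; apply/funext => u; rewrite exprS !exprD; ring.
rewrite mulrDr mulrDl IH; case: y {IH} => [|y].
  by rewrite !mulr0n !mul0r !mulr0 mul0r !add0r !add0n [rho ^+ _.+1]exprS expr0; ring.
rewrite addnS addSn addnS /= [rho ^+ _.+1]exprS ![t ^+ _.+1]exprS -addnA !exprD.
ring.
Qed.

(* [v'] and [w'] are [v / rho] and [w / (sigma * rho)], without divisions. *)
Lemma loop_scale (sigma rho t u v w r nu v' w' : K) F :
  v = rho * v' -> w = sigma * rho * w' ->
  solves_loop u v w r nu F ->
  solves_loop (t ^+ 2 * u) (t ^+ 2 * v') (t ^+ 2 * w') (rho * t ^+ 2 * r)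
    (sigma * rho * nu)
    (fun s => sigma * rho ^+ size s * t ^+ sumn s * F s).
Proof.
move=> vE wE hF [|k] s.
  by rewrite hF; case: s => [|y s] /=; rewrite ?mulr0 // expr1; ring.
rewrite hF [loop_step _ _ _ _ _ F _]/= [RHS]/=.
have T2 : t ^+ (k.+1 + sumn s) = t * t ^+ (k + sumn s) by rewrite addSn exprS.
(* Each term has degree two less than the left side, whence [t ^+ 2]. Compared with the left side,
   the number of entries is the same in the first term, one more in the two terms of the sum, one
   less in the last; the product also has a second factor [sigma]. *)
rewrite !mulrDr; congr (_ + _ + _).
- case: k T2 => [|k] T2; first by rewrite !(mulr0, mul0r).
  by rewrite /= T2 addSn [t ^+ _.+1]exprS; ring.
- rewrite mulr_sumr; apply: eq_bigr => i _.
  have E a : deriv_head a (fun u0 => sigma * rho ^+ size u0 * t ^+ sumn u0 * F u0) =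
    (fun u0 => (sigma * rho * t ^+ a) * rho ^+ size u0 * t ^+ sumn u0 * deriv_head a F u0).
    by apply/funext => x; rewrite /deriv_head /= exprS exprD; ring.
  rewrite !E shuffle_scale /=.
  have -> : (k.-1 - i + (i + sumn s) = k.-1 + sumn s)%N by have := ltn_ord i; lia.
  rewrite T2 vE wE !exprS.
  have -> : t ^+ (k + sumn s) = t * (t ^+ (k.-1 - i) * t ^+ i * t ^+ sumn s).
    by rewrite -!exprD -exprS; congr (_ ^+ _); have := ltn_ord i; lia.
  have -> : t ^+ (k.-1 + sumn s) = t ^+ (k.-1 - i) * t ^+ i * t ^+ sumn s.
    by rewrite -!exprD; congr (_ ^+ _); have := ltn_ord i; lia.
  ring.
- have := absorb_scale (sigma * rho) rho t k F s.
  rewrite T2 [rho ^+ size (_ :: _)]exprS -/(size s) => H.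
  transitivity (r * t * (sigma * rho * rho ^+ size s * t ^+ (k + sumn s) *
     absorb k (fun x => deriv_head x F) s)); first by ring.
  rewrite -H.
  have -> : (fun x => deriv_head x (fun s0 => sigma * rho ^+ size s0 * t ^+ sumn s0 * F s0)) =
    (fun x u0 => sigma * rho * rho ^+ size u0 * t ^+ (x + sumn u0) * F (x :: u0)).
    by apply/funext => x; apply/funext => z; rewrite /deriv_head /= exprS; ring.
  ring.
Qed.

End LoopRecursion.

Section LoopMorphism.
Variables (K L : comNzRingType) (phi : {rmorphism K -> L}).

Lemma rmorph_shuffle (T : Type) (F G : seq T -> K) s :
  phi (shuffle F G s) = shuffle (phi \o F) (phi \o G) s.
Proof.
by elim: s F G => [|x s IH] F G /=; rewrite ?rmorphM // rmorphD !IH.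
Qed.

Lemma rmorph_absorb k (g : nat -> seq nat -> K) s :
  phi (absorb k g s) = absorb k (fun x => phi \o g x) s.
Proof.
by elim: s g => [|y s IH] g /=; rewrite ?rmorph0 // rmorphD rmorphM rmorph_nat IH.
Qed.

(** Serves both to evaluate polynomial solutions at a point and to carry real solutions into the
    complex numbers. *)
Lemma rmorph_solves_loop u v w r nu F : solves_loop u v w r nu F ->
  solves_loop (phi u) (phi v) (phi w) (phi r) (phi nu) (phi \o F).
Proof.
move=> hF x s; rewrite [LHS]/= hF; case: x => [|k].
  by case: s => [|y s] //=; rewrite rmorph0.
rewrite /= !rmorphD !rmorphM rmorph_nat rmorph_sum rmorph_absorb.
congr (_ + _ + _); apply: eq_bigr => i _.
by rewrite rmorphD !rmorphM rmorph_shuffle.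
Qed.

End LoopMorphism.

(** * Cumulants as sums over set partitions *)

Section SetCumulant.
Variable K : comNzRingType.

Definition mobius_coef k : K := (-1) ^+ k.-1 * (k.-1)`!%:R.

Definition set_cumulant (I : finType) (M : {set I} -> K) (S : {set I}) : K :=
  \sum_(P : {set {set I}} | partition P S)
    mobius_coef #|P| * \prod_(B in P) M B.

Lemma mobius_coef_rec k : mobius_coef k.+1 + k%:R * mobius_coef k = (k == 0%N)%:R.
Proof.
rewrite /mobius_coef; case: k => [|k] /=; first by rewrite !mul0r addr0 mul1r.
by rewrite factS natrM exprS; ring.
Qed.

Lemma sum_partition_block (I : finType) (F : {set {set I}} -> K) (S B : {set I}) :
  B != set0 -> B \subset S ->
  \sum_(Q : {set {set I}} | partition Q S && (B \in Q)) F Q =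
  \sum_(P : {set {set I}} | partition P (S :\: B)) F (B |: P).
Proof.
move=> B0 BS.
rewrite (reindex_onto (fun P : {set {set I}} => B |: P) (fun Q => Q :\ B)) /=; last first.
  by move=> Q /andP[_ BQ]; rewrite setD1K.
apply: eq_bigl => P; rewrite setU11 andbT; apply/andP/idP => [[pQ /eqP PE]|pP].
  by have := partitionD1 pQ (setU11 B P); rewrite PE.
have BP : B \notin P.
  apply/negP => /(partitionS pP); rewrite subsetD -setI_eq0 setIid (negbTE B0).
  by rewrite andbF.
rewrite setU1K // eqxx; split=> //.
have := partitionU1 pP B0; rewrite setDE setUIr setUCr setIT (setUidPr BS); apply.
by rewrite -setDE -setI_eq0; apply/eqP/setP => x; rewrite !inE; case: (x \in B).
Qed.

Lemma card_partition_notin (I : finType) (S : {set I}) i (Q : {set {set I}}) :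
  i \in S -> partition Q S -> #|[set B in Q | i \notin B]| = #|Q|.-1.
Proof.
move=> iS pQ; have iQ : i \in cover Q by rewrite (cover_partition pQ).
have -> : [set B in Q | i \notin B] = Q :\ pblock Q i.
  apply/setP => B; rewrite !inE andbC; case BQ: (B \in Q); rewrite ?andbF // !andbT.
  congr (~~ _); apply/idP/eqP => [iB|->]; last by rewrite mem_pblock.
  by rewrite (def_pblock (partition_trivIset pQ) BQ iB).
by rewrite [in RHS](cardsD1 (pblock Q i)) pblock_mem.
Qed.

(** The set form of M' = C' M. A partition [Q] of [S] arises once with empty complement of [J], with
    coefficient [mobius_coef #|Q|], and once for each of the [#|Q|.-1] blocks avoiding [i], taken as
    that complement, with coefficient [mobius_coef #|Q|.-1]. By [mobius_coef_rec] these cancel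
    unless [Q] has a single block. *)
Lemma set_cumulant_rec (I : finType) (M : {set I} -> K) (S : {set I}) i :
  M set0 = 1 -> i \in S ->
  \sum_(J : {set I} | J \subset S :\ i) set_cumulant M (i |: J) * M ((S :\ i) :\: J)
    = M S.
Proof.
move=> M0 iS.
have -> : M S = \sum_(Q : {set {set I}} | partition Q S)
    (mobius_coef #|Q| + #|Q|.-1%:R * mobius_coef #|Q|.-1) * \prod_(B in Q) M B.
  have pS : partition [set S] S.
    rewrite /partition /cover big_set1 eqxx /= inE eq_sym.
    rewrite (introN eqP) ?andbT; last by move=> S0; rewrite S0 inE in iS.
    by apply/trivIsetP => A B; rewrite !inE => /eqP-> /eqP->; rewrite eqxx.
  rewrite (bigD1 [set S] pS) /= cards1 /= mul0r addr0 big_set1 big1 => [|Q /andP[pQ QS]].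
    by rewrite addr0 /mobius_coef /= expr0 !mul1r.
  have [Q0|] := posnP #|Q|.
    move: pQ; rewrite (cards0_eq Q0) => /cover_partition.
    by rewrite /cover big_set0 => S0; rewrite -S0 inE in iS.
  case Qn: #|Q| => [//|n] _; rewrite mobius_coef_rec; case: n Qn => [|n] Qn /=.
    move/eqP/cards1P: Qn => [B QB]; case/negP: QS.
    by have := cover_partition pQ; rewrite QB /cover big_set1 => ->.
  by rewrite mul0r.
under [RHS]eq_bigr do rewrite mulrDl.
(* The term [J = S :\ i] has empty complement and accounts for the first coefficient. *)
rewrite big_split /= (bigD1 (S :\ i)) //= setDv M0 mulr1 setD1K //; congr (_ + _).
transitivity (\sum_(Q : {set {set I}} | partition Q S) \sum_(B in Q | i \notin B)
    mobius_coef #|Q|.-1 * \prod_(B in Q) M B); last first.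
  apply: eq_bigr => Q pQ.
  transitivity (\sum_(B in [set B in Q | i \notin B])
      mobius_coef #|Q|.-1 * \prod_(B in Q) M B).
    by apply: eq_bigl => B; rewrite inE.
  by rewrite sumr_const (card_partition_notin iS pQ) -mulrA mulr_natl.
rewrite (exchange_big_dep (fun B : {set I} => (B \subset S :\ i) && (B != set0))) /=; last first.
  move=> Q B pQ /andP[BQ iB]; rewrite subsetD1 iB andbT (partitionS pQ BQ).
  exact: partition_neq0 pQ BQ.
(* [B] is the complement of [J] in [S :\ i]: the block contributed by the factor [M]. *)
rewrite (reindex_onto (fun B => (S :\ i) :\: B) (fun J => (S :\ i) :\: J)) /=; last first.
  by move=> J /andP[/setIidPr JS _]; rewrite setDDr setDv set0U.
have DD (B : {set I}) : (S :\ i) :\: ((S :\ i) :\: B) = (S :\ i) :&: B.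
  by rewrite setDDr setDv set0U.
apply: eq_big => B.
  rewrite DD subsetDl /=; apply/andP/andP => [[SB /eqP/setIidPr BS]|[BS B0]].
    by split=> //; apply: contraNneq SB => ->; rewrite setD0.
  split; last by apply/eqP/setIidPr.
  apply: contraNneq B0 => /(congr1 (setD (S :\ i))); rewrite DD setDv.
  by move/setIidPr: BS => -> /eqP.
rewrite DD => /andP[/andP[_ SB] /eqP BE]; rewrite BE.
have BS : B \subset S :\ i by apply/setIidPr.
have B0 : B != set0 by apply: contraNneq SB => ->; rewrite setD0.
move: BS; rewrite subsetD1 => /andP[BS iB].
have -> : i |: ((S :\ i) :\: B) = S :\: B.
  apply/setP => x; rewrite !inE; case: eqVneq => [->|_] //=; first by rewrite iS iB.
transitivity (\sum_(Q : {set {set I}} | partition Q S && (B \in Q))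
    mobius_coef #|Q|.-1 * \prod_(B in Q) M B); last first.
  by apply: eq_bigl => Q; rewrite iB andbT.
rewrite (sum_partition_block (fun Q => mobius_coef #|Q|.-1 * \prod_(B in Q) M B) B0 BS).
rewrite mulr_suml; apply: eq_bigr => P pP.
have BP : B \notin P.
  apply/negP => /(partitionS pP); rewrite subsetD -setI_eq0 setIid (negbTE B0).
  by rewrite andbF.
by rewrite cardsU1 BP add1n /= big_setU1 //= [M B * _]mulrC mulrA.
Qed.

Lemma set_cumulant_imset (I I' : finType) (f : I -> I') (M : {set I'} -> K)
    (S : {set I}) :
  injective f ->
  set_cumulant M (f @: S) = set_cumulant (fun B => M (f @: (B : {set I}))) S.
Proof.
move=> fI; rewrite /set_cumulant.
rewrite (reindex_onto (fun P : {set {set I}} => [set f @: (B : {set I}) | B in P])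
  (fun P' => [set f @^-1: (B : {set I'}) | B in P'])) /=; last first.
  move=> P' pP'; apply/setP => B; apply/imsetP/idP => [[C /imsetP[D DP ->] ->]|BP].
    suff -> : f @: (f @^-1: D) = D by [].
    apply/setP => x; apply/imsetP/idP => [[y]|xD]; first by rewrite inE => ? ->.
    have := subsetP (partitionS pP' DP) x xD => /imsetP[y _ xE].
    by exists y => //; rewrite inE -xE.
  exists (f @^-1: B); first exact: imset_f.
  apply/setP => x; apply/idP/imsetP => [xB|[y]]; last by rewrite inE => ? ->.
  have := subsetP (partitionS pP' BP) x xB => /imsetP[y _ xE].
  by exists y => //; rewrite inE -xE.
have fP (P : {set {set I}}) :
    [set f @^-1: B | B : {set I'} in [set f @: (B : {set I}) | B in P]] = P.
  have fK (B : {set I}) : f @^-1: (f @: B) = B.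
    by apply/setP => x; rewrite inE mem_imset.
  apply/setP => B; apply/imsetP/idP => [[_ /imsetP[D DP ->] ->]|BP]; first by rewrite fK.
  by exists (f @: B); [exact: imset_f|rewrite fK].
apply: eq_big => P; first by rewrite imset_partition // fP eqxx andbT.
move=> _; rewrite card_imset; last exact: imset_inj.
by rewrite big_imset //= => A B _ _; apply: imset_inj.
Qed.


(** The head of [l] lies either in [J] or in its complement, which are the two terms of the Leibniz
    rule. *)
Lemma sum_subset_shuffle (I : finType) (F G : {set I} -> K) (l : seq I) :
  uniq l ->
  \sum_(J : {set I} | J \subset [set:: l]) F J * G ([set:: l] :\: J) =
  shuffle (fun u => F [set:: u]) (fun u => G [set:: u]) l.
Proof.
elim: l F G => [|x l IH] F G /=.
  by rewrite set_nil (big_pred1 set0) ?setD0 // => J; rewrite subset0.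
move=> /andP[xl ul]; rewrite set_cons.
have xL : x \notin [set:: l] by rewrite inE.
have IH1 := IH (fun J => F (x |: J)) G ul.
have IH2 := IH F (fun J => G (x |: J)) ul.
have E (H : {set I} -> K) : deriv_head x (fun u => H [set:: u]) =
    (fun u => H (x |: [set:: u])).
  by apply/funext => u; rewrite /deriv_head set_cons.
rewrite !E -IH1 -IH2 (bigID (fun J : {set I} => x \in J)) /=; congr (_ + _).
  rewrite (reindex_onto (fun J => x |: J) (fun J => J :\ x)) /=; last first.
    by move=> J /andP[_ xJ]; rewrite setD1K.
  apply: eq_big => J; rewrite setU11 andbT.
    apply/andP/idP => [[JS /eqP JE]|JL].
      have xJ : x \notin J by rewrite -JE !inE eqxx.
      by move: (setSD [set x] JS); rewrite JE setU1K.
    have xJ : x \notin J by apply: contra xL; exact: (subsetP JL).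
    by rewrite setUS // setU1K.
  move=> /andP[_ /eqP JE]; congr (_ * G _).
  have xJ : x \notin J by rewrite -JE !inE eqxx.
  by apply/setP => y; rewrite !inE; case: eqVneq => [->|_] /=; rewrite ?(negbTE xl) ?andbF.
apply: eq_big => J.
  apply/andP/idP => [[JS xJ]|JL]; first by rewrite -(setU1K xL) subsetD1 JS.
  by split; [exact: subset_trans JL (subsetUr _ _)|apply: contra xL; exact: (subsetP JL)].
move=> /andP[_ xJ]; congr (_ * G _).
by apply/setP => y; rewrite !inE; case: eqVneq => [->|_] //=; rewrite xJ.
Qed.


(** Only subsequences of [s] matter; they inherit [uniq], which the passage between sets and lists
    requires. *)
Lemma eq_in_shuffle (T : eqType) (F F' G G' : seq T -> K) s :
  (forall u, subseq u s -> F u = F' u) -> (forall u, subseq u s -> G u = G' u) ->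
  shuffle F G s = shuffle F' G' s.
Proof.
elim: s F F' G G' => [|x s IH] F F' G G' FF GG /=; first by rewrite FF // GG.
have sub u : subseq u s -> subseq u (x :: s).
  by move=> us; apply: subseq_trans us (subseq_cons _ _).
have sub2 u : subseq u s -> subseq (x :: u) (x :: s) by rewrite /= eqxx.
congr (_ + _); apply: IH => u us.
- exact/FF/sub2.
- exact/GG/sub.
- exact/FF/sub.
- exact/GG/sub2.
Qed.

Lemma shuffle_map (T U : Type) (p : T -> U) (F G : seq U -> K) l :
  shuffle (fun u => F (map p u)) (fun u => G (map p u)) l = shuffle F G (map p l).
Proof. by elim: l F G => [|x l IH] F G //=; rewrite -!IH. Qed.

Section SeqCumulant.
Variables (T : eqType) (M : seq T -> K).
Hypothesis M_perm : forall s t, perm_eq s t -> M s = M t.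

Definition set_moment (I : finType) (p : I -> T) (B : {set I}) : K :=
  M [seq p i | i <- enum B].

(** Partitions are taken of the positions in [s], because exponents may repeat. *)
Definition seq_cumulant (s : seq T) : K :=
  set_cumulant (set_moment (tnth (in_tuple s))) setT.

Lemma set_moment_uniq (I : finType) (p : I -> T) l :
  uniq l -> set_moment p [set:: l] = M (map p l).
Proof.
move=> ul; apply/M_perm/perm_map/uniq_perm => //; first exact: enum_uniq.
by move=> x; rewrite mem_enum inE.
Qed.

Lemma set_moment_imset (I I' : finType) (f : I -> I') (p : I' -> T) (B : {set I}) :
  injective f -> set_moment p (f @: B) = set_moment (p \o f) B.
Proof.
move=> fI; apply: M_perm; rewrite (map_comp p f); apply/perm_map/uniq_perm.
- exact: enum_uniq.
- by rewrite map_inj_uniq // enum_uniq.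
move=> x; rewrite mem_enum; apply/imsetP/mapP => -[y yB ->]; exists y => //.
  by rewrite mem_enum.
by rewrite mem_enum in yB.
Qed.

Lemma set_cumulant_uniq (I : finType) (p : I -> T) l :
  uniq l -> set_cumulant (set_moment p) [set:: l] = seq_cumulant (map p l).
Proof.
move=> ul; pose f i := tnth (in_tuple l) (cast_ord (size_map p l) i).
have ltl (i : 'I_(size (map p l))) : (i < size l)%N.
  by rewrite -(size_map p); exact: ltn_ord.
have fI : injective f.
  move=> i j /eqP; rewrite /f !(tnth_nth (f i)) nth_uniq ?ltl //= => /eqP ij.
  exact: val_inj.
have -> : [set:: l] = f @: setT.
  apply/setP => x; rewrite inE; apply/idP/imsetP => [xl|[i _ ->]]; last exact: mem_tnth.
  have /tnthP[i ->] : x \in in_tuple l by [].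
  by exists (cast_ord (esym (size_map p l)) i) => //; rewrite /f cast_ordKV.
rewrite set_cumulant_imset // /seq_cumulant; congr (set_cumulant _ _).
apply/funext => B; rewrite set_moment_imset //; congr (set_moment _ _).
apply/funext => i /=; rewrite /f (tnth_nth (p (f i))) (tnth_nth (f i)) /=.
by rewrite (nth_map (f i)) ?ltl.
Qed.

(** This is [set_cumulant_rec] at position 0, which carries [x]; it supplies the logarithmic
    derivative that [cumulant_loop] assumes. *)
Lemma seq_cumulant_rec x : M [::] = 1 ->
  deriv_head x M =1 shuffle (deriv_head x seq_cumulant) M.
Proof.
move=> M0 s; pose p := tnth (in_tuple (x :: s)).
pose l := [seq lift ord0 i | i <- enum 'I_(size s)].
have El : enum 'I_(size s).+1 = ord0 :: l by exact: enum_ordSl.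
have pl : map p (ord0 :: l) = x :: s by rewrite -El; exact: map_tnth_enum.
have /andP[l0 ul] : uniq (ord0 :: l) by rewrite -El enum_uniq.
have TE : [set:: ord0 :: l] = setT.
  by rewrite -El; apply/setP => i; rewrite in_set in_setT mem_enum.
have MT : set_moment p setT = M (x :: s).
  by rewrite -TE set_moment_uniq ?pl // -El enum_uniq.
have TD : setT :\ ord0 = [set:: l] by rewrite -TE set_cons setU1K // in_set.
have := @set_cumulant_rec _ (set_moment p) setT ord0.
rewrite MT TD => MR; rewrite /deriv_head -MR ?in_setT //; last first.
  by rewrite /set_moment enum_set0.
rewrite (sum_subset_shuffle (fun J => set_cumulant (set_moment p) (ord0 |: J))) //.
have [px pl'] : p ord0 = x /\ map p l = s by case: pl.
rewrite -[X in _ = shuffle _ _ X]pl' -shuffle_map; apply: eq_in_shuffle => u ul'.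
  rewrite -set_cons set_cumulant_uniq /=.
    by rewrite px.
  by rewrite (subseq_uniq ul' ul) andbT; apply: contra l0; exact: mem_subseq.
by rewrite set_moment_uniq // (subseq_uniq ul' ul).
Qed.

End SeqCumulant.
End SetCumulant.

From mathcomp Require Import all_classical all_reals all_analysis.
From mathcomp Require Import measurable_realfun.

Import numFieldTopology.Exports numFieldNormedType.Exports.

Local Open Scope classical_set_scope.

(** * Integration over tuples *)

Section TupleIntegral.
Context {R : realType}.
Local Notation TR := (measurableTypeR R).
Local Notation leb := (@lebesgue_measure R).

Lemma oneDsqrV_integrable : leb.-integrable setT (fun x => ((oneDsqr x)^-1)%:E).
Proof.
have c := @continuous_oneDsqrV R.
apply/integrableP; split.
  by apply/measurable_EFinP; apply: continuous_measurable_fun.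
under eq_integral do rewrite gee0_abs ?lee_fin ?invr_ge0 //.
have h0 (x : R) : 0 <= (oneDsqr x)^-1 by rewrite invr_ge0.
rewrite (ge0_symfun_integralT h0 c) => [|x /=]; last by rewrite /oneDsqr sqrrN.
by rewrite -set_itvcy integral0y_oneDsqr -EFinM ltry.
Qed.

Lemma ge0_integral_lebesgue_cons N (f : N.+1.-tuple TR -> \bar R) :
  measurable_fun setT f -> (forall t, (0 <= f t)%E) ->
  (\int[lebesgue_tuple N.+1]_t f t =
   \int[leb \x lebesgue_tuple N]_v f (tuple_cons v))%E.
Proof.
move=> mf f0.
have := @ge0_integral_pushforward _ _ _ _ R _ (@measurable_tuple_cons R N)
  (leb \x lebesgue_tuple N)%E setT f measurableT mf (fun y _ => f0 y).
by [].
Qed.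

Lemma measurable_fun_tuple_cons d (T : measurableType d) N
    (f : N.+1.-tuple TR -> T) :
  measurable_fun setT f -> measurable_fun setT (f \o @tuple_cons R N).
Proof. by move=> mf; exact: measurableT_comp mf (@measurable_tuple_cons R N). Qed.

Lemma integrable_lebesgue_cons N (f : N.+1.-tuple TR -> \bar R) :
  measurable_fun setT f -> (lebesgue_tuple N.+1).-integrable setT f ->
  (leb \x lebesgue_tuple N)%E.-integrable setT (f \o @tuple_cons R N).
Proof.
move=> mf /integrableP[_ fi]; apply/integrableP; split.
  exact: measurable_fun_tuple_cons.
apply: le_lt_trans fi; rewrite ge0_integral_lebesgue_cons //.
exact: measurableT_comp.
Qed.

Lemma integral_lebesgue_cons N (f : N.+1.-tuple TR -> \bar R) :
  (lebesgue_tuple N.+1).-integrable setT f ->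
  (\int[lebesgue_tuple N.+1]_t f t =
   \int[leb \x lebesgue_tuple N]_v f (tuple_cons v))%E.
Proof.
move=> fi; have mf := measurable_int _ fi.
exact: (@integral_pushforward _ _ _ _ R _ (@measurable_tuple_cons R N)
  (leb \x lebesgue_tuple N)%E setT f mf (integrable_lebesgue_cons mf fi) measurableT).
Qed.

Lemma measurable_prod_tnth N (f : nat -> R -> R) :
  (forall i, measurable_fun setT (f i)) ->
  measurable_fun setT (fun t : N.-tuple TR => \prod_(i < N) f i (tnth t i)).
Proof.
move=> mf; apply: measurable_prod => i _.
by apply: (measurableT_comp (mf i)); exact: measurable_tnth.
Qed.

Lemma integral_lebesgue_tuple_prod N (f : nat -> R -> R) :
  (forall i, measurable_fun setT (f i)) -> (forall i x, 0 <= f i x) ->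
  (\int[lebesgue_tuple N]_t (\prod_(i < N) f i (tnth t i))%:E =
   \prod_(i < N) \int[leb]_x (f i x)%:E)%E.
Proof.
elim: N f => [|N IH] f mf f0.
  rewrite /= integral_dirac //; last first.
    by apply/measurable_EFinP; exact: measurable_prod_tnth.
  by rewrite diracT mul1e !big_ord0.
have mF : measurable_fun setT
    (fun t : N.+1.-tuple TR => (\prod_(i < N.+1) f i (tnth t i))%:E).
  by apply/measurable_EFinP; exact: measurable_prod_tnth.
rewrite ge0_integral_lebesgue_cons //; last first.
- by move=> t; rewrite lee_fin prodr_ge0.
rewrite fubini_tonelli1; last 2 first.
- exact: measurable_fun_tuple_cons mF.
- by move=> t; rewrite lee_fin prodr_ge0.
rewrite big_ord_recl -(IH (fun i => f i.+1)) //.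
rewrite -ge0_integralZr //=; last 3 first.
- by apply/measurable_EFinP; exact: mf.
- by move=> x _; rewrite lee_fin.
- by apply: integral_ge0 => t _; rewrite lee_fin prodr_ge0.
apply: eq_integral => x _.
rewrite /fubini_F -ge0_integralZl //=; last 3 first.
- by apply/measurable_EFinP; exact: (measurable_prod_tnth (fun i => mf i.+1)).
- by move=> t _; rewrite lee_fin prodr_ge0.
- by rewrite lee_fin.
apply: eq_integral => t _; rewrite -EFinM big_ord_recl /=; congr (_ * _)%:E.
by apply: eq_bigr => i _; rewrite tnthS.
Qed.

End TupleIntegral.

(** * Integration along a single coordinate *)

Section Coordinate.
Context {R : realType}.
Local Notation TR := (measurableTypeR R).
Local Notation leb := (@lebesgue_measure R).

Definition tuple_upd N (t : N.-tuple TR) (j : 'I_N) (x : R) : N.-tuple TR :=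
  [tuple if i == j then x else tnth t i | i < N].

(** A common majorant of product form: with all coordinates but one frozen, it is a constant times
    1/(1 + x^2), which is integrable and also makes boundary terms vanish. *)
Definition decay N (t : N.-tuple TR) : R := \prod_(i < N) (oneDsqr (tnth t i))^-1.

Lemma decay_ge0 N (t : N.-tuple TR) : 0 <= decay t.
Proof. by rewrite prodr_ge0 // => i _; rewrite invr_ge0. Qed.

Lemma measurable_oneDsqrV : measurable_fun setT (fun x : R => (oneDsqr x)^-1).
Proof. by apply: continuous_measurable_fun; exact: continuous_oneDsqrV. Qed.

Lemma decay_integrable N : (lebesgue_tuple N).-integrable setT (EFin \o @decay N).
Proof.
have mV := measurable_oneDsqrV.
apply/integrableP; split.
  by apply/measurable_EFinP; exact: (measurable_prod_tnth (fun=> mV)).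
under eq_integral do rewrite gee0_abs ?lee_fin ?decay_ge0 //.
rewrite [X in (X < _)%E]
  (@integral_lebesgue_tuple_prod R N (fun=> fun x => (oneDsqr x)^-1)); last 2 first.
- by move=> _; exact: mV.
- by move=> _ x; rewrite invr_ge0.
rewrite ltey_eq prode_fin_num // => i _.
by apply: integrable_fin_num => //; exact: oneDsqrV_integrable.
Qed.

Lemma dominated_integrable N (f : N.-tuple TR -> R) C :
  measurable_fun setT f -> (forall t, `|f t| <= C * decay t) ->
  (lebesgue_tuple N).-integrable setT (EFin \o f).
Proof.
move=> mf fC.
apply: (@le_integrable _ _ _ _ _ measurableT _ (fun t => (C * decay t)%:E)).
- exact/measurable_EFinP.
- by move=> t _; rewrite /= lee_fin (le_trans (fC t)) // ler_norm.
- under eq_fun do rewrite EFinM.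
  by apply: integrableZl => //; exact: decay_integrable.
Qed.

Lemma tuple_upd_cons0 N (x y : R) (v : N.-tuple TR) :
  tuple_upd (tuple_cons (x, v)) ord0 y = tuple_cons (y, v).
Proof.
apply: eq_from_tnth => i; rewrite tnth_mktuple.
by case: (unliftP ord0 i) => [k ->|->] /=; rewrite ?tnthS ?tnth0.
Qed.

Lemma tuple_upd_consS N (x y : R) (v : N.-tuple TR) j :
  tuple_upd (tuple_cons (x, v)) (lift ord0 j) y = tuple_cons (x, tuple_upd v j y).
Proof.
apply: eq_from_tnth => i; rewrite tnth_mktuple.
case: (unliftP ord0 i) => [k ->|->] /=; rewrite ?tnthS ?tnth0 //.
by rewrite tnth_mktuple (inj_eq lift_inj).
Qed.

Lemma decay_cons N (x : R) (v : N.-tuple TR) :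
  decay (tuple_cons (x, v)) = (oneDsqr x)^-1 * decay v.
Proof.
rewrite /decay big_ord_recl /=; congr (_ * _).
by apply: eq_bigr => i _; rewrite tnthS.
Qed.

(** Fubini with coordinate [j] innermost. As [lebesgue_tuple] adjoins coordinates at the front, a
    later one is reached by freezing the first, whose decay factor is moved into [C]. *)
Lemma integral_coordinate_eq0 N (j : 'I_N) (f : N.-tuple TR -> R) C :
  measurable_fun setT f -> (forall t, `|f t| <= C * decay t) ->
  (forall t, \int[leb]_x (f (tuple_upd t j x))%:E = 0)%E ->
  (\int[lebesgue_tuple N]_t (f t)%:E = 0)%E.
Proof.
elim: N j f C => [[]//|N IH] j f C mf fC f0.
have fi := dominated_integrable mf fC.
rewrite integral_lebesgue_cons //.
have fi' : (leb \x lebesgue_tuple N)%E.-integrable setT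
    (fun v => (f (tuple_cons v))%:E).
  by apply: (integrable_lebesgue_cons _ fi); exact/measurable_EFinP.
case: (unliftP ord0 j) => [k jE|jE].
  rewrite -integral12_prod_meas1 //; apply: integral0_eq => x _.
  rewrite /fubini_F; apply: (IH k (fun v => f (tuple_cons (x, v))) (C * (oneDsqr x)^-1)).
  - apply: (measurableT_comp (measurable_fun_tuple_cons mf)).
    exact: measurable_pair1.
  - by move=> t; rewrite -mulrA -decay_cons.
  - move=> t; rewrite -[RHS](f0 (tuple_cons (x, t))) jE.
    by apply: eq_integral => y _; rewrite tuple_upd_consS.
rewrite -integral21_prod_meas1 //; apply: integral0_eq => v _.
(* The entry 0 is a placeholder that [tuple_upd] overwrites. *)
rewrite /fubini_G -[RHS](f0 (tuple_cons (0, v))) jE.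
by apply: eq_integral => y _; rewrite tuple_upd_cons0.
Qed.

Lemma dominated_convergence_EFin d (T : measurableType d)
    (mu : {measure set T -> \bar R}) (f_ : nat -> T -> R) (f g : T -> R) :
  (forall n, measurable_fun setT (f_ n)) -> measurable_fun setT f ->
  (forall x, f_ n x @[n --> \oo] --> f x) ->
  mu.-integrable setT (EFin \o g) -> (forall n x, `|f_ n x| <= g x) ->
  (\int[mu]_x (f_ n x)%:E)%E @[n --> \oo] --> (\int[mu]_x (f x)%:E)%E.
Proof.
move=> mf_ mf f_f ig f_g.
have [|||//||//] := @dominated_convergence _ T R mu setT measurableT
  (fun n => EFin \o f_ n) (EFin \o f) (EFin \o g).
- by move=> n; exact/measurable_EFinP.
- exact/measurable_EFinP.
- by apply: aeW => x _; apply: cvg_EFin; [exact: nearW|exact: f_f].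
- by apply: aeW => x n _; rewrite lee_fin.
Qed.

Lemma integral_derivative_eq0 (G g : R -> R) C :
  (forall x : R, is_derive x 1 G (g x)) -> continuous g ->
  (forall x, `|G x| <= C * (oneDsqr x)^-1) ->
  (forall x, `|g x| <= C * (oneDsqr x)^-1) ->
  (\int[leb]_x (g x)%:E = 0)%E.
Proof.
move=> dG cg bG bg.
have cG : continuous G.
  by move=> x; apply: differentiable_continuous; apply/derivable1_diffP; exact: ex_derive.
(* The shift keeps every interval nondegenerate, and 1/(1 + a^2) is at most 1/a, which is
   [harmonic n], at both endpoints. *)
pose a (n : nat) : R := n.+1%:R.
have a_gt0 n : 0 < a n by rewrite ltr0n.
have FTC n : (\int[leb]_(x in `[(- a n)%R, a n]) (g x)%:E = (G (a n) - G (- a n))%:E)%E.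
  rewrite (@continuous_FTC2 _ _ G) //.
  - by rewrite gtrN.
  - exact: continuous_subspaceT.
  - split.
    + by move=> x _; exact: ex_derive.
    + by apply: cvg_at_right_filter; exact: cG.
    + by apply: cvg_at_left_filter; exact: cG.
  - by move=> x _; rewrite derive1E derive_val.
have mg : measurable_fun setT g by exact: continuous_measurable_fun.
have C0 : 0 <= C.
  have := le_trans (normr_ge0 _) (bg 0).
  by rewrite /oneDsqr expr0n addr0 invr1 mulr1.
pose f_ n := g \_ `[- a n, a n].
have mf_ n : measurable_fun setT (f_ n).
  by apply/(measurable_restrictT _ _).1 => //; apply: measurable_funTS.
have f_cvg x : f_ n x @[n --> \oo] --> g x.
  apply: cvg_near_cst; near=> n; rewrite /f_ patchE mem_set //=.
  rewrite in_itv /= -ler_norml ltW // (lt_le_trans (archi_boundP (normr_ge0 _))) //.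
  rewrite ler_nat ltnW // ltnS; near: n; exact: nbhs_infty_ge.
have f_le n x : `|f_ n x| <= C * (oneDsqr x)^-1.
  rewrite /f_ patchE; case: ifPn => _ //.
  by rewrite normr0 mulr_ge0 // invr_ge0.
have iC : leb.-integrable setT (EFin \o (fun x => C * (oneDsqr x)^-1)).
  rewrite /comp; under eq_fun do rewrite EFinM.
  by apply: integrableZl => //; exact: oneDsqrV_integrable.
have := @dominated_convergence_EFin _ TR leb _ _ _ mf_ mg f_cvg iC f_le.
have E n : (\int[leb]_x (f_ n x)%:E = (G (a n) - G (- a n))%:E)%E.
  by rewrite -FTC [RHS]integral_mkcond; apply: eq_integral => x _; rewrite restrict_EFin.
under eq_fun do rewrite E.
move=> /cvg_lim <- //; apply/cvg_lim => //; apply: cvg_EFin; first by near=> n.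
rewrite /comp /=.
have c0 : 2 * C * harmonic n @[n --> \oo] --> (0 : R).
  rewrite -[0](mulr0 (2 * C)); apply: cvgMr; exact: cvg_harmonic.
apply: norm_cvg0; apply: (squeeze_cvgr _ (cvg_cst 0) c0); near=> n.
rewrite normr_ge0 /=.
have bn y : y ^+ 2 = a n ^+ 2 -> `|G y| <= C * harmonic n.
  move=> yE; apply: le_trans (bG y) _; rewrite ler_wpM2l // /harmonic /=.
  rewrite lef_pV2 ?posrE ?ltr0n // /oneDsqr yE.
  by rewrite (le_trans (_ : _ <= a n ^+ 2)) ?lerDr // expr2 ler_peMl // ler1n.
rewrite (le_trans (ler_normB _ _)) // -mulrA mulr_natl mulr2n lerD // bn //.
by rewrite sqrrN.
Unshelve. all: by end_near.
Qed.

End Coordinate.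

(** * Polynomially bounded functions *)

Lemma prodr_ge1 (K : numDomainType) (I : Type) (r : seq I) (P : pred I) (F : I -> K) :
  (forall i, P i -> 1 <= F i) -> 1 <= \prod_(i <- r | P i) F i.
Proof.
by move=> F1; elim/big_ind: _ => // x y x1 y1; exact: mulr_ege1.
Qed.

Section Admissible.
Context {R : realType} {N : nat}.
Local Notation TR := (measurableTypeR R).
Local Notation T := (N.-tuple TR).
Implicit Types (f g : T -> R) (t : T).

(** The bound has the product shape of [decay], so a Gaussian factor can absorb it coordinate by
    coordinate. *)
Definition poly_bounded f := exists m C, 0 <= C /\
  forall t, `|f t| <= C * \prod_(i < N) oneDsqr (tnth t i) ^+ m.

Definition admissible f := measurable_fun setT f /\ poly_bounded f.

Let prod1 t m : 1 <= \prod_(i < N) oneDsqr (tnth t i) ^+ m.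
Proof. by apply: prodr_ge1 => i _; rewrite exprn_ege1 ?oneDsqr_ge1. Qed.

Let prodD t m n : \prod_(i < N) oneDsqr (tnth t i) ^+ (m + n) =
  \prod_(i < N) oneDsqr (tnth t i) ^+ m * \prod_(i < N) oneDsqr (tnth t i) ^+ n.
Proof. by rewrite -big_split; apply: eq_bigr => i _; rewrite exprD. Qed.

Lemma poly_bounded_le f g : (forall t, `|f t| <= `|g t|) -> poly_bounded g -> poly_bounded f.
Proof.
by move=> fg [m [C [C0 gC]]]; exists m, C; split=> // t; exact: le_trans (fg t) (gC t).
Qed.

Lemma poly_bounded_cst c : poly_bounded (fun=> c).
Proof.
by exists 0%N, `|c|; split=> // t; rewrite ler_peMr.
Qed.

Lemma poly_bounded_tnth i : poly_bounded (fun t => tnth t i).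
Proof.
exists 1%N, 1; split=> // t; rewrite mul1r (bigD1 i) //= expr1.
rewrite (le_trans (_ : _ <= oneDsqr (tnth t i))) ?ler_peMr //.
- rewrite /oneDsqr -[in leRHS]real_normK ?num_real //.
  have := normr_ge0 (tnth t i); move: `|_| => x; nra.
- by apply: prodr_ge1 => k _; rewrite exprn_ege1 ?oneDsqr_ge1.
Qed.

Lemma poly_boundedD f g : poly_bounded f -> poly_bounded g ->
  poly_bounded (fun t => f t + g t).
Proof.
move=> [m [C [C0 fC]]] [n [D [D0 gD]]]; exists (m + n)%N, (C + D); split.
  exact: addr_ge0.
move=> t; rewrite (le_trans (ler_normD _ _)) // mulrDl lerD //.
- by rewrite (le_trans (fC t)) // prodD mulrA ler_peMr // mulr_ge0 // ltW // (lt_le_trans ltr01).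
- by rewrite (le_trans (gD t)) // addnC prodD mulrA ler_peMr // mulr_ge0 // ltW // (lt_le_trans ltr01).
Qed.

Lemma poly_boundedM f g : poly_bounded f -> poly_bounded g ->
  poly_bounded (fun t => f t * g t).
Proof.
move=> [m [C [C0 fC]]] [n [D [D0 gD]]]; exists (m + n)%N, (C * D); split.
  exact: mulr_ge0.
by move=> t; rewrite normrM prodD mulrACA ler_pM.
Qed.

Lemma admissible_cst c : admissible (fun=> c).
Proof. by split; [exact: measurable_cst|exact: poly_bounded_cst]. Qed.

Lemma admissible_tnth i : admissible (fun t => tnth t i).
Proof. by split; [exact: measurable_tnth|exact: poly_bounded_tnth]. Qed.

Lemma admissibleD f g : admissible f -> admissible g -> admissible (fun t => f t + g t).
Proof.
by move=> [? ?] [? ?]; split; [exact: measurable_funD|exact: poly_boundedD].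
Qed.

Lemma admissibleM f g : admissible f -> admissible g -> admissible (fun t => f t * g t).
Proof.
by move=> [? ?] [? ?]; split; [exact: measurable_funM|exact: poly_boundedM].
Qed.

Lemma admissibleN f : admissible f -> admissible (fun t => - f t).
Proof.
move=> af; rewrite (_ : (fun t => - f t) = (fun t => -1 * f t)).
  exact/admissibleM/af/admissible_cst.
by apply/funext => t; rewrite mulN1r.
Qed.

Lemma admissibleB f g : admissible f -> admissible g -> admissible (fun t => f t - g t).
Proof. by move=> af ag; exact/admissibleD/admissibleN. Qed.

Lemma admissibleX f n : admissible f -> admissible (fun t => f t ^+ n).
Proof.
move=> af; elim: n => [|n IH]; first exact: admissible_cst.
by under eq_fun do rewrite exprS; exact: admissibleM.
Qed.

Lemma admissible_sum (I : Type) (r : seq I) (P : pred I) (F : I -> T -> R) :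
  (forall i, P i -> admissible (F i)) ->
  admissible (fun t => \sum_(i <- r | P i) F i t).
Proof.
move=> aF; elim: r => [|i r IH].
  by under eq_fun do rewrite big_nil; exact: admissible_cst.
case Pi: (P i); under eq_fun do rewrite big_cons Pi; last by [].
by apply: admissibleD => //; exact: aF.
Qed.

Lemma admissible_prod (I : Type) (r : seq I) (P : pred I) (F : I -> T -> R) :
  (forall i, P i -> admissible (F i)) ->
  admissible (fun t => \prod_(i <- r | P i) F i t).
Proof.
move=> aF; elim: r => [|i r IH].
  by under eq_fun do rewrite big_nil; exact: admissible_cst.
case Pi: (P i); under eq_fun do rewrite big_cons Pi; last by [].
by apply: admissibleM => //; exact: aF.
Qed.

Lemma admissible_comp (phi : R -> R) f : continuous phi ->
  (exists C (n : nat), forall x, `|phi x| <= C * (1 + x ^+ 2) ^+ n) ->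
  admissible f -> admissible (fun t => phi (f t)).
Proof.
move=> cphi [C [n phin]] [mf bf]; split.
  by apply: measurableT_comp mf; exact: continuous_measurable_fun.
apply: (poly_bounded_le (g := fun t => C * (1 + f t ^+ 2) ^+ n)).
  by move=> t; rewrite (le_trans (phin _)) // ler_norm.
apply: poly_boundedM; first exact: poly_bounded_cst.
elim: n {phin} => [|n IH]; first exact: poly_bounded_cst.
under eq_fun do rewrite exprS; apply: poly_boundedM => //.
by apply: poly_boundedD; [exact: poly_bounded_cst|exact: poly_boundedM].
Qed.

Lemma gauss_decay (c : R) m : 0 < c -> exists2 C, 0 <= C & forall t,
  expR (- (c * \sum_(i < N) tnth t i ^+ 2)) * \prod_(i < N) oneDsqr (tnth t i) ^+ m <=
  C * decay t.
Proof.
(* With [d <= 1], d (1 + x^2) <= 1 + d x^2 <= exp (d x^2). Raised to the power m + 1 this stays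
   below exp (c x^2), because d (m + 1) <= c. *)
move=> c0; pose d := Num.min 1 (c / m.+1%:R).
have d0 : 0 < d by rewrite lt_min ltr01 divr_gt0.
have d1 : d <= 1 by rewrite ge_min lexx.
have dc : d * m.+1%:R <= c by rewrite -ler_pdivlMr // ge_min lexx orbT.
have B x : expR (- (c * x ^+ 2)) * oneDsqr x ^+ m <= (d^-1) ^+ m.+1 * (oneDsqr x)^-1.
  have x2 := sqr_ge0 x.
  have o0 : 0 < oneDsqr x by rewrite /oneDsqr; lra.
  rewrite ler_pdivlMr // -mulrA -exprSr expRN ler_pdivrMl ?expR_gt0 //.
  rewrite exprVn ler_pdivlMr ?exprn_gt0 // -exprMn.
  apply: (@le_trans _ _ (expR (d * x ^+ 2) ^+ m.+1)).
    apply: lerXn2r; rewrite ?nnegrE ?expR_ge0 //.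
      by rewrite mulr_ge0 // ltW.
    apply: le_trans (expR_ge1Dx _); rewrite /oneDsqr; nra.
  by rewrite -expRM_natr ler_expR mulrAC ler_wpM2r.
exists ((d^-1) ^+ m.+1 ^+ N) => [|t]; first by rewrite !exprn_ge0 // invr_ge0 ltW.
rewrite mulr_sumr -sumrN expR_sum -big_split /=.
rewrite -[X in _ ^+ X]card_ord -prodr_const /decay -big_split /=.
by apply: ler_prod => i _; rewrite B mulr_ge0 ?expR_ge0 // exprn_ge0.
Qed.

End Admissible.

(** * The regularized density *)

Section RegularizedWeight.
Context {R : realType} {N : nat}.
Local Notation TR := (measurableTypeR R).
Local Notation T := (N.-tuple TR).
Implicit Types (f g : T -> R) (t : T) (c kappa eps : R).

Definition reg_interaction kappa eps t : R :=
  \prod_(j < N) \prod_(k < N | (j < k)%N)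
    ((tnth t k - tnth t j) ^+ 2 + eps) `^ kappa.

Definition reg_weight c kappa eps t : R :=
  expR (- (c * \sum_(i < N) tnth t i ^+ 2)) * reg_interaction kappa eps t.

Lemma ensemble_weight_gauss c kappa t :
  ensemble_weight (fun x => expR (- (c * x ^+ 2))) kappa t = reg_weight c kappa 0 t.
Proof.
rewrite /ensemble_weight /reg_weight mulr_sumr -sumrN expR_sum; congr (_ * _).
apply: eq_bigr => j _; apply: eq_bigr => k _.
by rewrite addr0 powRrM powR_mulrn // real_normK ?num_real.
Qed.

Lemma reg_interaction_ge0 kappa eps t : 0 <= reg_interaction kappa eps t.
Proof. by apply: prodr_ge0 => j _; apply: prodr_ge0 => k _; exact: powR_ge0. Qed.

Lemma reg_weight_ge0 c kappa eps t : 0 <= reg_weight c kappa eps t.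
Proof. by rewrite mulr_ge0 ?expR_ge0 // reg_interaction_ge0. Qed.

Lemma reg_weight_le c kappa eps t : 0 <= kappa -> 0 <= eps <= 1 ->
  reg_weight c kappa eps t <= reg_weight c kappa 1 t.
Proof.
move=> k0 /andP[e0 e1]; rewrite ler_wpM2l ?expR_ge0 //.
apply: ler_prod => i _; apply/andP; split.
  by apply: prodr_ge0 => k _; exact: powR_ge0.
apply: ler_prod => k _; rewrite powR_ge0 /=.
by apply: ge0_ler_powR; rewrite ?nnegrE ?addr_ge0 ?sqr_ge0 // lerD2l.
Qed.

Lemma measurable_reg_weight c kappa eps :
  measurable_fun setT (reg_weight c kappa eps).
Proof.
apply: measurable_funM.
  apply: measurableT_comp; first exact: measurable_expR.
  apply: measurableT_comp; first exact: oppr_measurable.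
  by apply: measurable_funM => //; apply: measurable_sum => i; apply: measurable_funX; exact: measurable_tnth.
apply: measurable_prod => j _.
rewrite /=; under eq_fun do rewrite big_mkcond.
apply: measurable_prod => k _; case: (j < k)%N => //=.
apply: (@measurableT_comp _ _ _ _ _ _ (fun u : R => u `^ kappa)); first exact: measurable_powR.
apply: measurable_funD => //; apply: measurable_funX.
by apply: measurable_funB; exact: measurable_tnth.
Qed.

(** The derivative is written as the function times its logarithmic derivative, the form in which
    [pdiff_prod] adds up the factors of a product without dividing by any. *)
Lemma is_derive_sqrD_powR kappa eps (x : R) : 0 < eps ->
  is_derive x 1 (fun u : R => (u ^+ 2 + eps) `^ kappa)
    ((x ^+ 2 + eps) `^ kappa * (kappa * 2 * (x / (x ^+ 2 + eps)))).
Proof.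
move=> e0; have p : 0 < x ^+ 2 + eps by rewrite ltr_wpDl ?sqr_ge0.
have d1 : is_derive x 1 (fun u : R => u ^+ 2 + eps) (2 * x).
  apply: is_derive_eq; rewrite addr0 /GRing.scale /= !mulr1; ring.
have dp := @is_derive1_comp _ _ (fun u : R => u ^+ 2 + eps) _ _ _ (is_derive1_powR kappa p) d1.
apply: (is_derive_eq (f := (powR (R:=R))^~ kappa \o (fun u : R => u ^+ 2 + eps)) dp).
rewrite powRD; last by rewrite (gt_eqF p) implybT.
rewrite powR_inv1 ?(ltW p) //; field.
by rewrite gt_eqF.
Qed.

Lemma continuous_sqrD_powR kappa eps : 0 < eps ->
  continuous (fun u : R => (u ^+ 2 + eps) `^ kappa).
Proof.
move=> e0 x; apply: differentiable_continuous; apply/derivable1_diffP.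
exact: (@ex_derive _ _ _ _ _ _ _ (is_derive_sqrD_powR kappa x e0)).
Qed.

Lemma admissible_reg_interaction1 kappa : 0 <= kappa ->
  admissible (reg_interaction kappa 1).
Proof.
move=> k0; apply: admissible_prod => j _; apply: admissible_prod => k _.
apply: (@admissible_comp _ _ (fun u => (u ^+ 2 + 1) `^ kappa)).
- exact: continuous_sqrD_powR.
- exists 1, (Num.bound kappa) => x; rewrite mul1r.
  rewrite ger0_norm ?powR_ge0 // [_ + 1]addrC.
  rewrite -[leRHS]powR_mulrn ?addr_ge0 ?sqr_ge0 //.
  apply: ler_powR; first by rewrite lerDl sqr_ge0.
  by rewrite ltW // archi_boundP.
- by apply: admissibleB; exact: admissible_tnth.
Qed.

(** [C] does not depend on [eps]: the weight increases with [eps], so its value at [eps = 1]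
    dominates. Dominated convergence relies on this uniformity. *)
Lemma reg_weight_decay c kappa f : 0 < c -> 0 <= kappa -> poly_bounded f ->
  exists2 C, 0 <= C & forall eps t, 0 <= eps <= 1 ->
    `|f t| * reg_weight c kappa eps t <= C * decay t.
Proof.
move=> c0 k0 bf.
have [m [C [C0 fC]]] := poly_boundedM bf (admissible_reg_interaction1 k0).2.
have [D D0 gD] := @gauss_decay R N c m c0.
exists (C * D) => [|eps t e01]; first exact: mulr_ge0.
apply: (@le_trans _ _ (`|f t| * reg_weight c kappa 1 t)).
  by rewrite ler_wpM2l // reg_weight_le.
rewrite -mulrA; apply: le_trans (ler_wpM2l C0 (gD t)).
rewrite /reg_weight mulrCA [leRHS]mulrCA ler_wpM2l ?expR_ge0 //.
by have := fC t; rewrite normrM (ger0_norm (reg_interaction_ge0 _ _ _)).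
Qed.

Lemma admissible_integrable c kappa eps f : 0 < c -> 0 <= kappa -> 0 <= eps <= 1 ->
  admissible f ->
  (lebesgue_tuple N).-integrable setT (EFin \o (fun t => f t * reg_weight c kappa eps t)).
Proof.
move=> c0 k0 e01 [mf bf]; have [C C0 fC] := reg_weight_decay c0 k0 bf.
apply: (@dominated_integrable _ _ _ C).
  by apply: measurable_funM => //; exact: measurable_reg_weight.
by move=> t; rewrite normrM (ger0_norm (reg_weight_ge0 _ _ _ _)) fC.
Qed.

Lemma reg_weight_cvg c kappa t : 0 < kappa ->
  reg_weight c kappa (harmonic n) t @[n --> \oo] --> reg_weight c kappa 0 t.
Proof.
move=> k0; apply: cvgMr.
apply: cvg_big => [|j _]; first exact: mul_continuous.
apply: cvg_big => [|k _]; first exact: mul_continuous.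
set u := _ - _; rewrite addr0.
have ch : (u ^+ 2 + harmonic n : R) @[n --> \oo] --> u ^+ 2.
  rewrite -[X in _ --> X]addr0; apply: cvgD; [exact: cvg_cst|exact: cvg_harmonic].
(* At a coincidence the power need not be differentiable at 0; right-continuity there, valid for
   [kappa > 0], suffices because [harmonic n] is positive. *)
have [u0|u0] := eqVneq u 0.
  rewrite u0 expr0n /= powR0 ?gt_eqF //.
  under eq_cvg do rewrite add0r.
  move/cvg_at_rightP: (powR_cvg0 k0) => /(_ (@harmonic R)); apply; split.
    by move=> n; exact: harmonic_gt0.
  exact: cvg_harmonic.
have u2 : 0 < u ^+ 2 by rewrite exprn_even_gt0.
apply: (@cvg_comp _ _ _ (fun n => u ^+ 2 + harmonic n) (fun v => v `^ kappa) _ _ _ ch).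
apply: (@differentiable_continuous _ _ _ _ (fun v : R => v `^ kappa)).
apply/derivable1_diffP.
exact: (@ex_derive _ _ _ _ _ _ _ (is_derive1_powR kappa u2)).
Qed.

End RegularizedWeight.

(** * Integration by parts *)

Section PartialDerivatives.
Context {R : realType} {N : nat}.
Local Notation TR := (measurableTypeR R).
Local Notation T := (N.-tuple TR).
Implicit Types (f g : T -> R) (t : T) (j : 'I_N).

Definition pdiff j f f' := forall t (x : R),
  is_derive x 1 (fun y : R => f (tuple_upd t j y)) (f' (tuple_upd t j x)).

(** Continuity in one coordinate is all that the one-variable fundamental theorem of calculus asks
    for. *)
Definition pcont j f := forall t, continuous (fun y : R => f (tuple_upd t j y)).

Lemma pdiff_pcont j f f' : pdiff j f f' -> pcont j f.
Proof.
move=> df t x; apply: differentiable_continuous; apply/derivable1_diffP.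
exact: (@ex_derive _ _ _ _ _ _ _ (df t x)).
Qed.

Lemma eq_pdiff j f f' g g' : f =1 g -> f' =1 g' -> pdiff j f f' -> pdiff j g g'.
Proof. by move=> /funext <- /funext <-. Qed.

Lemma pdiff_cst j c : pdiff j (fun=> c) (fun=> 0).
Proof. by move=> t x; exact: is_derive_cst. Qed.

Lemma pdiff_tnth j i : pdiff j (fun t => tnth t i) (fun=> (i == j)%:R).
Proof.
move=> t x; under eq_fun do rewrite tnth_mktuple.
by case: eqVneq => _; [exact: is_derive_id|exact: is_derive_cst].
Qed.

Lemma pdiffD j f f' g g' : pdiff j f f' -> pdiff j g g' ->
  pdiff j (fun t => f t + g t) (fun t => f' t + g' t).
Proof. by move=> df dg t x; exact: (is_deriveD (df t x) (dg t x)). Qed.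

Lemma pdiffM j f f' g g' : pdiff j f f' -> pdiff j g g' ->
  pdiff j (fun t => f t * g t) (fun t => f' t * g t + f t * g' t).
Proof.
move=> df dg t x; apply: (is_derive_eq (is_deriveM (df t x) (dg t x))).
by rewrite addrC /GRing.scale /= [X in X + _]mulrC.
Qed.

Lemma pdiff_sum j (I : Type) (r : seq I) (P : pred I) (F F' : I -> T -> R) :
  (forall i, pdiff j (F i) (F' i)) ->
  pdiff j (fun t => \sum_(i <- r | P i) F i t) (fun t => \sum_(i <- r | P i) F' i t).
Proof.
move=> dF; elim: r => [|i r IH].
  by apply: eq_pdiff (pdiff_cst j 0) => t; rewrite big_nil.
case Pi: (P i); last by apply: eq_pdiff IH => t; rewrite big_cons Pi.
by apply: eq_pdiff (pdiffD (dF i) IH) => t; rewrite big_cons Pi.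
Qed.

Lemma pdiffX j f f' n : pdiff j f f' ->
  pdiff j (fun t => f t ^+ n) (fun t => n%:R * f t ^+ n.-1 * f' t).
Proof.
move=> df; elim: n => [|n IH].
  by apply: eq_pdiff (pdiff_cst j 1) => t; rewrite ?expr0 ?mul0r.
apply: eq_pdiff (pdiffM df IH) => t /=; first by rewrite exprS.
by case: n {IH} => [|n]; rewrite ?exprS /= ?expr0; ring.
Qed.

Lemma pdiff_comp j (phi phi' : R -> R) f f' :
  (forall x : R, is_derive x 1 phi (phi' x)) -> pdiff j f f' ->
  pdiff j (fun t => phi (f t)) (fun t => phi' (f t) * f' t).
Proof.
move=> dphi df t x.
exact: (@is_derive1_comp _ phi (fun y => f (tuple_upd t j y)) _ _ _ (dphi _) (df t x)).
Qed.

Lemma pdiff_prod j (I : Type) (r : seq I) (P : pred I) (F L : I -> T -> R) :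
  (forall i, pdiff j (F i) (fun t => F i t * L i t)) ->
  pdiff j (fun t => \prod_(i <- r | P i) F i t)
    (fun t => (\prod_(i <- r | P i) F i t) * \sum_(i <- r | P i) L i t).
Proof.
move=> dF; elim: r => [|i r IH].
  by apply: eq_pdiff (pdiff_cst j 1) => t; rewrite !big_nil ?mulr0.
case Pi: (P i); last by apply: eq_pdiff IH => t; rewrite !big_cons Pi.
by apply: eq_pdiff (pdiffM (dF i) IH) => t; rewrite !big_cons Pi //; ring.
Qed.

Lemma eq_pcont j f g : f =1 g -> pcont j f -> pcont j g.
Proof. by move=> /funext <-. Qed.

Lemma pcontD j f g : pcont j f -> pcont j g -> pcont j (fun t => f t + g t).
Proof. by move=> cf cg t x; apply: cvgD; [exact: cf|exact: cg]. Qed.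

Lemma pcontM j f g : pcont j f -> pcont j g -> pcont j (fun t => f t * g t).
Proof. by move=> cf cg t x; apply: cvgM; [exact: cf|exact: cg]. Qed.

Lemma pcont_cst j c : pcont j (fun=> c).
Proof. exact: pdiff_pcont (pdiff_cst j c). Qed.

Lemma pcont_tnth j i : pcont j (fun t => tnth t i).
Proof. exact: pdiff_pcont (pdiff_tnth j i). Qed.

Lemma pcont_sum j (I : Type) (r : seq I) (P : pred I) (F : I -> T -> R) :
  (forall i, pcont j (F i)) -> pcont j (fun t => \sum_(i <- r | P i) F i t).
Proof.
by move=> cF t x; apply: cvg_big => [|i _]; [exact: add_continuous|exact: cF].
Qed.

Lemma pcont_comp j (phi : R -> R) f : continuous phi -> pcont j f ->
  pcont j (fun t => phi (f t)).
Proof. by move=> cphi cf t x; apply: continuous_comp; [exact: cf|exact: cphi]. Qed.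

Lemma pcontX j f n : pcont j f -> pcont j (fun t => f t ^+ n).
Proof.
by move=> cf; apply: (pcont_comp (phi := fun x => x ^+ n)) => //; exact: exprn_continuous.
Qed.

Lemma decay_upd t j (x : R) : decay (tuple_upd t j x) =
  \prod_(i < N | i != j) (oneDsqr (tnth t i))^-1 * (oneDsqr x)^-1.
Proof.
rewrite /decay (bigD1 j) //= tnth_mktuple eqxx mulrC; congr (_ * _).
by apply: eq_bigr => i /negPf ij; rewrite tnth_mktuple ij.
Qed.

Lemma integral_pdiff_eq0 j f f' C D :
  pdiff j f f' -> pcont j f' -> measurable_fun setT f' ->
  (forall t, `|f t| <= C * decay t) -> (forall t, `|f' t| <= D * decay t) ->
  (\int[lebesgue_tuple N]_t (f' t)%:E = 0)%E.
Proof.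
move=> df cf mf fC fD; apply: (@integral_coordinate_eq0 _ _ j f' D) => // t.
set K := \prod_(i < N | i != j) (oneDsqr (tnth t i))^-1.
have K0 : 0 <= K by rewrite prodr_ge0 // => i _; rewrite invr_ge0.
apply: (@integral_derivative_eq0 _ (fun y => f (tuple_upd t j y)) _ (Num.max C D * K)).
- exact: df.
- exact: cf.
- move=> x; apply: le_trans (fC _) _; rewrite decay_upd -mulrA ler_wpM2r ?le_max ?lexx //.
  by rewrite mulr_ge0 // invr_ge0.
- move=> x; apply: le_trans (fD _) _; rewrite decay_upd -mulrA ler_wpM2r ?le_max ?lexx ?orbT //.
  by rewrite mulr_ge0 // invr_ge0.
Qed.

End PartialDerivatives.

(** * Power sums and the divergence of the vector fields *)

Section PowerSums.
Context {R : realType} {N : nat}.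
Local Notation TR := (measurableTypeR R).
Local Notation T := (N.-tuple TR).
Implicit Types (t : T) (j : 'I_N) (s : seq nat) (k : nat).

Definition power_sum k t : R := \sum_(l < N) tnth t l ^+ k.

Definition power_sums s t : R := \prod_(x <- s) power_sum x t.

Fixpoint dpower_sums j s t : R :=
  if s is x :: s' then
    x%:R * tnth t j ^+ x.-1 * power_sums s' t + power_sum x t * dpower_sums j s' t
  else 0.

Lemma power_sums_cons x s t : power_sums (x :: s) t = power_sum x t * power_sums s t.
Proof. by rewrite /power_sums big_cons. Qed.

Lemma admissible_power_sum k : admissible (power_sum k).
Proof. by apply: admissible_sum => l _; apply: admissibleX; exact: admissible_tnth. Qed.

Lemma admissible_power_sums s : admissible (power_sums s).
Proof. by apply: admissible_prod => x _; exact: admissible_power_sum. Qed.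

Lemma admissible_dpower_sums j s : admissible (dpower_sums j s).
Proof.
elim: s => [|x s IH] /=; first exact: admissible_cst.
apply: admissibleD; apply: admissibleM => //.
- apply: admissibleM; first exact: admissible_cst.
  by apply: admissibleX; exact: admissible_tnth.
- exact: admissible_power_sums.
- exact: admissible_power_sum.
Qed.

Lemma pdiff_power_sum j k : pdiff j (power_sum k) (fun t => k%:R * tnth t j ^+ k.-1).
Proof.
apply: eq_pdiff (pdiff_sum _ _ (fun l => pdiffX k (pdiff_tnth j l))) => // t.
rewrite (bigD1 j) //= eqxx mulr1 big1 ?addr0 // => i /negPf ->.
by rewrite mulr0.
Qed.

Lemma pdiff_power_sums j s : pdiff j (power_sums s) (dpower_sums j s).
Proof.
elim: s => [|x s IH].
  by apply: eq_pdiff (pdiff_cst j 1) => t; rewrite /power_sums ?big_nil.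
by apply: eq_pdiff (pdiffM (pdiff_power_sum j x) IH) => t; rewrite ?power_sums_cons.
Qed.

Lemma pcont_power_sum j k : pcont j (power_sum k).
Proof. exact: pdiff_pcont (pdiff_power_sum j k). Qed.

Lemma pcont_power_sums j s : pcont j (power_sums s).
Proof. exact: pdiff_pcont (pdiff_power_sums j s). Qed.

Lemma pcont_dpower_sums j s : pcont j (dpower_sums j s).
Proof.
elim: s => [|x s IH] /=; first exact: pcont_cst.
apply: pcontD; apply: pcontM => //.
- by apply: pcontM; [exact: pcont_cst|apply: pcontX; exact: pcont_tnth].
- exact: pcont_power_sums.
- exact: pcont_power_sum.
Qed.

(** Differentiating the power sum of exponent y and multiplying by lambda_j^k gives y
    lambda_j^(k+y-1), which sums over j to a power sum again. The factor [a] is there for the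
    induction, where it collects the power sums already passed. *)
Lemma sum_dpower_sums k s t (a : R) :
  a * \sum_(j < N) tnth t j ^+ k * dpower_sums j s t =
  absorb k (fun x u => a * power_sums (x :: u) t) s.
Proof.
elim: s a => [|y s IH] a /=; first by rewrite big1 ?mulr0 // => j _; rewrite mulr0.
have -> : absorb k (fun x u => a * power_sums [:: x, y & u] t) s =
    a * power_sum y t * \sum_(j < N) tnth t j ^+ k * dpower_sums j s t.
  rewrite IH; congr (absorb _ _ _); apply/funext => x; apply/funext => u.
  by rewrite !power_sums_cons; ring.
under eq_bigr do rewrite mulrDr; rewrite big_split /= mulrDr; congr (_ + _); last first.
  rewrite -mulrA; congr (_ * _); rewrite mulr_sumr.
  by apply: eq_bigr => j _; ring.
rewrite power_sums_cons /power_sum mulr_suml !mulr_sumr; apply: eq_bigr => j _.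
case: y {IH} => [|y]; first by rewrite !mul0r !mulr0.
by rewrite addnS /= exprD; ring.
Qed.

(** The logarithmic derivative of [reg_weight] along coordinate [j]. *)
Definition score c kappa eps j t : R :=
  - (c * (2 * tnth t j)) +
  \sum_(a < N) \sum_(b < N | (a < b)%N)
    kappa * 2 * ((tnth t b - tnth t a) / ((tnth t b - tnth t a) ^+ 2 + eps)) *
    ((b == j)%:R - (a == j)%:R).

Lemma pdiff_reg_weight c kappa eps j : 0 < eps ->
  pdiff j (reg_weight c kappa eps)
    (fun t => reg_weight c kappa eps t * score c kappa eps j t).
Proof.
move=> e0.
have d1 : pdiff j (fun t => - (c * \sum_(i < N) tnth t i ^+ 2))
    (fun t => - (c * (2 * tnth t j))).
  by apply: eq_pdiff (pdiffM (pdiff_cst j (- c)) (pdiff_power_sum j 2)) => t; rewrite /power_sum /= ?expr1; ring.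
have d2 := pdiff_comp (@is_derive_expR R) d1.
have dd a b : pdiff j (fun t => tnth t b - tnth t a)
    (fun=> (b == j)%:R - (a == j)%:R).
  by apply: eq_pdiff (pdiffD (pdiff_tnth j b) (pdiffM (pdiff_cst j (-1)) (pdiff_tnth j a))) => t; ring.
have d3 a b : pdiff j (fun t => ((tnth t b - tnth t a) ^+ 2 + eps) `^ kappa)
    (fun t => ((tnth t b - tnth t a) ^+ 2 + eps) `^ kappa * (kappa * 2 *
      ((tnth t b - tnth t a) / ((tnth t b - tnth t a) ^+ 2 + eps)) *
    ((b == j)%:R - (a == j)%:R))).
  by apply: eq_pdiff (pdiff_comp (fun x => is_derive_sqrD_powR kappa x e0) (dd a b)) => t //; rewrite !mulrA.
have d4 := pdiff_prod (index_enum _) xpredT (fun a : 'I_N =>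
  pdiff_prod (index_enum _) (fun b : 'I_N => (a < b)%N) (d3 a)).
by apply: eq_pdiff (pdiffM d2 d4) => t //; rewrite /reg_weight /score /reg_interaction; ring.
Qed.

Let dot_continuous eps : 0 < eps -> continuous (fun u : R => u / (u ^+ 2 + eps)).
Proof.
move=> e0 u; apply: cvgM; first exact: cvg_id.
apply: cvgV; first by rewrite gt_eqF // ltr_wpDl ?sqr_ge0.
by apply: cvgD; [exact: exprn_continuous|exact: cvg_cst].
Qed.

Lemma pcont_score c kappa eps j : 0 < eps -> pcont j (score c kappa eps j).
Proof.
move=> e0; apply: pcontD.
  by apply: eq_pcont (pcontM (@pcont_cst R N j (- (c * 2))) (@pcont_tnth R N j j)) => t; ring.
apply: pcont_sum => a; apply: pcont_sum => b.
apply: pcontM; last exact: pcont_cst.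
apply: pcontM; first exact: pcont_cst.
apply: (pcont_comp (phi := fun u => u / (u ^+ 2 + eps))); first exact: dot_continuous.
apply: pcontD; first exact: pcont_tnth.
by apply: eq_pcont (pcontM (@pcont_cst R N j (- 1)) (@pcont_tnth R N j a)) => t; ring.
Qed.

(** The bound uses 1/eps, so it justifies integration by parts only at fixed [eps]; uniform control
    appears after summing over [j]. *)
Lemma admissible_score c kappa eps j : 0 < eps -> admissible (score c kappa eps j).
Proof.
move=> e0; apply: admissibleD.
  apply: admissibleN; apply: admissibleM; first exact: admissible_cst.
  by apply: admissibleM; [exact: admissible_cst|exact: admissible_tnth].
apply: admissible_sum => a _; apply: admissible_sum => b _.
apply: admissibleM; last exact: admissible_cst.
apply: admissibleM; first exact: admissible_cst.
apply: (admissible_comp (phi := fun u => u / (u ^+ 2 + eps))).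
- exact: dot_continuous.
- exists eps^-1, 1%N => x; rewrite expr1 normrM normfV.
  have p : 0 < x ^+ 2 + eps by rewrite ltr_wpDl ?sqr_ge0.
  rewrite (gtr0_norm p) mulrC ler_pM ?invr_ge0 ?(ltW p) //.
    by rewrite lef_pV2 ?posrE // lerDr sqr_ge0.
  rewrite -real_normK ?num_real //; have := normr_ge0 x; move: `|x| => y; nra.
- by apply: admissibleB; exact: admissible_tnth.
Qed.

(* The j-th partial derivative of lambda_j^k * power_sums s * density, divided by
   the density. *)
Definition loop_field k s c kappa eps j t : R :=
  k%:R * tnth t j ^+ k.-1 * power_sums s t + tnth t j ^+ k * dpower_sums j s t +
  tnth t j ^+ k * power_sums s t * score c kappa eps j t.

Lemma admissible_loop_field k s c kappa eps j : 0 < eps ->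
  admissible (loop_field k s c kappa eps j).
Proof.
move=> e0; have aX n := admissibleX n (@admissible_tnth R N j).
apply: admissibleD; first apply: admissibleD.
- apply: admissibleM; last exact: admissible_power_sums.
  by apply: admissibleM; first exact: admissible_cst.
- by apply: admissibleM => //; exact: admissible_dpower_sums.
- apply: admissibleM; last exact: admissible_score.
  by apply: admissibleM => //; exact: admissible_power_sums.
Qed.

Lemma integral_loop_field k s c kappa eps j : 0 < c -> 0 <= kappa -> 0 < eps <= 1 ->
  (\int[lebesgue_tuple N]_t
    (loop_field k s c kappa eps j t * reg_weight c kappa eps t)%:E = 0)%E.
Proof.
move=> c0 k0 /andP[e0 e1]; have e01 : 0 <= eps <= 1 by rewrite ltW.
have aX n := admissibleX n (@admissible_tnth R N j).
have aF := admissibleM (aX k) (admissible_power_sums s).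
have aL := admissible_loop_field k s c kappa j e0.
have [C C0 fC] := reg_weight_decay c0 k0 aF.2.
have [D D0 gD] := reg_weight_decay c0 k0 aL.2.
apply: (@integral_pdiff_eq0 _ _ j
    (fun t => tnth t j ^+ k * power_sums s t * reg_weight c kappa eps t) _ C D).
- by apply: eq_pdiff (pdiffM (pdiffM (pdiffX k (pdiff_tnth j j)) (pdiff_power_sums j s))
    (pdiff_reg_weight c kappa j e0)) => t //; rewrite /loop_field eqxx mulr1; ring.
- apply: pcontM; last exact: pdiff_pcont (pdiff_reg_weight c kappa j e0).
  have cX n : pcont j (fun t => tnth t j ^+ n) by apply: pcontX; exact: pcont_tnth.
  apply: pcontD; first apply: pcontD.
  + apply: pcontM; last exact: pcont_power_sums.
    by apply: pcontM; first exact: pcont_cst.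
  + by apply: pcontM => //; exact: pcont_dpower_sums.
  + apply: pcontM; last exact: pcont_score.
    by apply: pcontM => //; exact: pcont_power_sums.
- by apply: measurable_funM; [exact: aL.1|exact: measurable_reg_weight].
- by move=> t; rewrite normrM (ger0_norm (reg_weight_ge0 _ _ _ _)) fC.
- by move=> t; rewrite normrM (ger0_norm (reg_weight_ge0 _ _ _ _)) gD.
Qed.

End PowerSums.

(** * Loop equation *)

Section LoopEquation.
Context {R : realType} {N : nat}.
Local Notation TR := (measurableTypeR R).
Local Notation T := (N.-tuple TR).
Implicit Types (t : T) (s : seq nat) (k : nat).

(** The quotient (x^k - y^k) / (x - y), written as a polynomial so that it makes sense at
    [x = y]. *)
Definition divided_diff k (x y : R) : R := \sum_(i < k) x ^+ (k.-1 - i) * y ^+ i.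

(* At eps = 0 the quotient is 1, except for 0 / 0 = 0 on the diagonal, where the
   density vanishes. *)
Definition pair_kernel k eps t : R :=
  \sum_(a < N) \sum_(b < N | (a < b)%N)
    ((tnth t b - tnth t a) ^+ 2 / ((tnth t b - tnth t a) ^+ 2 + eps)) *
    divided_diff k (tnth t b) (tnth t a).

Definition loop_core k s c t : R :=
  k%:R * power_sum k.-1 t * power_sums s t +
  \sum_(j < N) tnth t j ^+ k * dpower_sums j s t -
  2 * c * power_sum k.+1 t * power_sums s t.

Lemma subrXX_divided k (x y : R) : x ^+ k - y ^+ k = (x - y) * divided_diff k x y.
Proof.
by rewrite subrXX; congr (_ * _); apply: eq_bigr => i _; congr (_ ^+ _ * _); lia.
Qed.

(** Summing over [j] removes the singularity: for u = lambda_b - lambda_a, the pair (a, b)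
    contributes u/(u^2 + eps) times lambda_b^k - lambda_a^k, and the latter is divisible by u. What
    remains is u^2/(u^2 + eps), which stays within [0, 1]. *)
Lemma sum_loop_field k s c kappa eps t :
  \sum_(j < N) loop_field k s c kappa eps j t =
  loop_core k s c t + 2 * kappa * power_sums s t * pair_kernel k eps t.
Proof.
rewrite /loop_field !big_split /= /loop_core -!addrA.
rewrite {1}/power_sum mulr_sumr mulr_suml; congr (_ + (_ + _)).
rewrite /score; under eq_bigr do rewrite mulrDr.
rewrite big_split /= /power_sum mulr_sumr mulr_suml -sumrN; congr (_ + _).
  by apply: eq_bigr => j _; rewrite exprS; ring.
under eq_bigr do rewrite mulr_sumr.
rewrite exchange_big mulr_sumr /=; apply: eq_bigr => a _.
under eq_bigr do rewrite mulr_sumr.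
rewrite exchange_big mulr_sumr /=; apply: eq_bigr => b _.
set u := tnth t b - _.
have E : \sum_(j < N) tnth t j ^+ k * ((b == j)%:R - (a == j)%:R) =
    u * divided_diff k (tnth t b) (tnth t a).
  rewrite -subrXX_divided; under eq_bigr do rewrite mulrBr.
  rewrite sumrB (bigD1 b) //= eqxx mulr1 big1 ?addr0; last first.
    by move=> j /negPf jb; rewrite eq_sym jb mulr0.
  rewrite (bigD1 a) //= eqxx mulr1 big1 ?addr0 //.
  by move=> j /negPf ja; rewrite eq_sym ja mulr0.
transitivity (2 * kappa * power_sums s t * (u / (u ^+ 2 + eps)) *
    \sum_(j < N) tnth t j ^+ k * ((b == j)%:R - (a == j)%:R)).
  by rewrite mulr_sumr; apply: eq_bigr => j _; ring.
by rewrite E expr2; ring.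
Qed.

Lemma divided_diffC k (x y : R) : divided_diff k x y = divided_diff k y x.
Proof.
rewrite /divided_diff (reindex_inj rev_ord_inj) /=; apply: eq_bigr => i _.
rewrite mulrC; congr (_ ^+ _ * _ ^+ _); have := ltn_ord i; lia.
Qed.

Lemma divided_diffxx k (x : R) : divided_diff k x x = k%:R * x ^+ k.-1.
Proof.
rewrite /divided_diff (eq_bigr (fun=> x ^+ k.-1)); last first.
  by move=> i _; rewrite -exprD; congr (_ ^+ _); have := ltn_ord i; lia.
by rewrite sumr_const card_ord mulr_natl.
Qed.

(** The double sum over all pairs factors into power sums. By symmetry it is twice the sum over a <
    b plus the diagonal, and the diagonal is the subtracted term. *)
Lemma pair_sum k t :
  2 * \sum_(a < N) \sum_(b < N | (a < b)%N) divided_diff k (tnth t b) (tnth t a) =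
  \sum_(i < k) power_sum (k.-1 - i) t * power_sum i t - k%:R * power_sum k.-1 t.
Proof.
set h := fun a b => divided_diff k (tnth t b) (tnth t a).
have -> : \sum_(i < k) power_sum (k.-1 - i) t * power_sum i t = \sum_a \sum_b h a b.
  rewrite exchange_big /= /h /divided_diff.
  under [RHS]eq_bigr do rewrite exchange_big /=.
  rewrite exchange_big /=; apply: eq_bigr => i _.
  rewrite /power_sum mulr_suml; apply: eq_bigr => b _; exact: mulr_sumr.
have -> : k%:R * power_sum k.-1 t = \sum_a h a a.
  by rewrite /power_sum mulr_sumr; apply: eq_bigr => a _; rewrite /h divided_diffxx.
have split3 a : \sum_b h a b =
    \sum_(b < N | (a < b)%N) h a b + (\sum_(b < N | (b < a)%N) h a b + h a a).
  rewrite (bigID (fun b : 'I_N => (a < b)%N)) /=; congr (_ + _).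
  rewrite (bigD1 a) ?ltnn //= addrC; congr (_ + _).
  by apply: eq_bigl => b; rewrite -leqNgt ltn_neqAle andbC.
under [X in _ = X - _]eq_bigr do rewrite split3.
rewrite !big_split /= addrA addrK mulr_natl mulr2n; congr (_ + _).
rewrite [RHS](exchange_big_dep xpredT) //=; apply: eq_bigr => a _.
by apply: eq_bigr => b _; rewrite /h divided_diffC.
Qed.

Lemma admissible_divided_diff k a b :
  admissible (fun t => divided_diff k (tnth t b) (tnth t a)).
Proof.
apply: admissible_sum => i _.
by apply: admissibleM; apply: admissibleX; exact: admissible_tnth.
Qed.

Lemma admissible_loop_core k s c : admissible (loop_core k s c).
Proof.
apply: admissibleB; first apply: admissibleD.
- apply: admissibleM; last exact: admissible_power_sums.
  by apply: admissibleM; [exact: admissible_cst|exact: admissible_power_sum].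
- apply: admissible_sum => j _; apply: admissibleM; last exact: admissible_dpower_sums.
  by apply: admissibleX; exact: admissible_tnth.
- apply: admissibleM; last exact: admissible_power_sums.
  by apply: admissibleM; [exact: admissible_cst|exact: admissible_power_sum].
Qed.

Lemma admissible_norm (f : T -> R) : admissible f -> admissible (fun t => `|f t|).
Proof.
move=> af; apply: admissible_comp af; first exact: norm_continuous.
exists 1, 1%N => x; rewrite normr_id mul1r expr1 -real_normK ?num_real //.
have := normr_ge0 x; move: `|x| => y; nra.
Qed.

Lemma pair_kernel_reg_weight0 k c kappa t : 0 < kappa ->
  pair_kernel k 0 t * reg_weight c kappa 0 t =
  (\sum_(a < N) \sum_(b < N | (a < b)%N) divided_diff k (tnth t b) (tnth t a)) *
  reg_weight c kappa 0 t.
Proof.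
move=> k0; rewrite !mulr_suml; apply: eq_bigr => a _.
rewrite !mulr_suml; apply: eq_bigr => b ab.
have [u0|u0] := eqVneq (tnth t b - tnth t a) 0; last first.
  by rewrite addr0 divff ?mul1r // expf_neq0.
suff -> : reg_weight c kappa 0 t = 0 by rewrite !mulr0.
rewrite /reg_weight /reg_interaction [X in _ * X](bigD1 a) //=.
rewrite [X in _ * (X * _)](bigD1 b) //= u0 expr0n addr0.
by rewrite powR0 ?gt_eqF // !(mul0r, mulr0).
Qed.

Lemma integral_loop k s c kappa : 0 < c -> 0 < kappa ->
  (\int[lebesgue_tuple N]_t
    ((loop_core k s c t + kappa * power_sums s t *
      (\sum_(i < k) power_sum (k.-1 - i) t * power_sum i t - k%:R * power_sum k.-1 t)) *
     reg_weight c kappa 0 t)%:E = 0)%E.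
Proof.
move=> c0 k0.
pose G eps t := (loop_core k s c t + 2 * kappa * power_sums s t * pair_kernel k eps t) *
  reg_weight c kappa eps t.
(* Replacing each quotient u^2/(u^2 + eps) by 1 gives a majorant free of [eps]. *)
pose B t := `|loop_core k s c t| + `|2 * kappa * power_sums s t| *
  \sum_(a < N) \sum_(b < N | (a < b)%N) `|divided_diff k (tnth t b) (tnth t a)|.
have aB : admissible B.
  apply: admissibleD; first exact/admissible_norm/admissible_loop_core.
  apply: admissibleM.
    by apply/admissible_norm/admissibleM; [exact: admissible_cst|exact: admissible_power_sums].
  by apply: admissible_sum => a _; apply: admissible_sum => b _; exact/admissible_norm/admissible_divided_diff.
have [C C0 BC] := reg_weight_decay c0 (ltW k0) aB.2.
have h01 n : 0 < (harmonic n : R) <= 1.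
  by rewrite /harmonic /= invr_gt0 ltr0n /= invf_le1 ?ler1n.
have GE n : G (harmonic n) = fun t => \sum_(j < N)
    loop_field k s c kappa (harmonic n) j t * reg_weight c kappa (harmonic n) t.
  by apply/funext => t; rewrite -mulr_suml sum_loop_field.
have aG n : admissible (fun t => \sum_(j < N) loop_field k s c kappa (harmonic n) j t).
  by apply: admissible_sum => j _; apply: admissible_loop_field; case/andP: (h01 n).
have mG n : measurable_fun setT (G (harmonic n)).
  rewrite (_ : G _ = fun t => (\sum_(j < N) loop_field k s c kappa (harmonic n) j t) *
      reg_weight c kappa (harmonic n) t).
    by apply: measurable_funM; [exact: (aG n).1|exact: measurable_reg_weight].
  by apply/funext => t; rewrite sum_loop_field.
have G0 n : (\int[lebesgue_tuple N]_t (G (harmonic n) t)%:E = 0)%E.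
  rewrite GE; under eq_integral do rewrite -sumEFin.
  rewrite integral_sum //= => [|j].
    by apply: big1 => j _; apply: (integral_loop_field _ _ _ c0 (ltW k0) (h01 n)).
  have /andP[h0 h1] := h01 n; apply: admissible_integrable => //.
  - exact: ltW.
  - by rewrite ltW.
  - exact: admissible_loop_field.
have pk_cvg t : pair_kernel k (harmonic n) t @[n --> \oo] --> pair_kernel k 0 t.
  apply: cvg_big => [|a _]; first exact: add_continuous.
  apply: cvg_big => [|b _]; first exact: add_continuous.
  set u := tnth t b - _; apply: cvgM; last exact: cvg_cst.
  have [->|u0] := eqVneq u 0; first by under eq_cvg do rewrite expr0n mul0r; rewrite expr0n mul0r; exact: cvg_cst.
  apply: cvgM; first exact: cvg_cst.
  apply: cvgV; first by rewrite addr0 expf_neq0.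
  by apply: cvgD; [exact: cvg_cst|exact: cvg_harmonic].
have G_cvg t : G (harmonic n) t @[n --> \oo] --> G 0 t.
  apply: cvgM; last exact: reg_weight_cvg.
  by apply: cvgD; [exact: cvg_cst|apply: cvgM => //; exact: cvg_cst].
have GC n t : `|G (harmonic n) t| <= C * decay t.
  have e01 : 0 <= (harmonic n : R) <= 1 by case/andP: (h01 n) => /ltW -> ->.
  apply: le_trans (BC _ t e01); rewrite normrM (ger0_norm (reg_weight_ge0 _ _ _ _)).
  rewrite ler_wpM2r ?reg_weight_ge0 // [leRHS]ger0_norm; last first.
    rewrite addr_ge0 // mulr_ge0 // sumr_ge0 // => a _; exact: sumr_ge0.
  rewrite (le_trans (ler_normD _ _)) // lerD2l normrM ler_wpM2l //.
  rewrite (le_trans (ler_norm_sum _ _ _)) //; apply: ler_sum => a _.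
  rewrite (le_trans (ler_norm_sum _ _ _)) //; apply: ler_sum => b _.
  rewrite normrM ler_piMl // normrM normfV.
  set u := (_ - _) ^+ 2; have u0 : 0 <= u by exact: sqr_ge0.
  have h0 := proj1 (andP (h01 n)).
  by rewrite !ger0_norm ?addr_ge0 ?(ltW h0) // ler_pdivrMr ?ltr_wpDl // mul1r lerDl ltW.
have mG0 : measurable_fun setT (G 0).
  by apply: measurable_fun_cvg mG _ => t _; exact: G_cvg.
have iC : (lebesgue_tuple N).-integrable setT (EFin \o (fun t => C * decay t)).
  rewrite /comp; under eq_fun do rewrite EFinM.
  by apply: integrableZl => //; exact: decay_integrable.
have := dominated_convergence_EFin mG mG0 G_cvg iC GC.
under eq_fun do rewrite G0.
move=> /(cvg_lim (@ereal_hausdorff R)); rewrite lim_cst // => ->.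
apply: eq_integral => t _; congr _%:E.
rewrite /G -pair_sum [in RHS]mulrDl [in LHS]mulrDl -!mulrA pair_kernel_reg_weight0 //.
by congr (_ + _); ring.
Qed.

End LoopEquation.

(** * Gaussian means and the loop equation for moments *)

Section GaussianMean.
Context {R : realType} {N : nat}.
Local Notation TR := (measurableTypeR R).
Local Notation T := (N.-tuple TR).
Implicit Types (t : T) (s : seq nat) (k : nat) (c kappa : R) (f g : T -> R).

Definition gauss_mean c kappa f : R :=
  ensemble_mean (fun x => expR (- (c * x ^+ 2))) kappa f.

Local Notation W c kappa := (reg_weight c kappa 0).
Local Notation Z c kappa := (\int[lebesgue_tuple N]_t W c kappa t).

Lemma gauss_meanE c kappa f : gauss_mean c kappa f =
  (\int[lebesgue_tuple N]_t (f t * W c kappa t)) / Z c kappa.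
Proof.
rewrite /gauss_mean /ensemble_mean; congr (_ / _); apply: eq_Rintegral => t _;
  by rewrite ensemble_weight_gauss.
Qed.

Lemma admissible_weight_integrable c kappa f : 0 < c -> 0 < kappa -> admissible f ->
  (lebesgue_tuple N).-integrable setT (EFin \o (fun t => f t * W c kappa t)).
Proof.
by move=> c0 k0 af; apply: admissible_integrable => //; rewrite ?lexx ?ler01 ?ltW.
Qed.

Lemma reg_weight_integrable c kappa : 0 < c -> 0 < kappa ->
  (lebesgue_tuple N).-integrable setT (EFin \o W c kappa).
Proof.
move=> c0 k0; have := admissible_weight_integrable c0 k0 (@admissible_cst R N 1).
by rewrite /comp; under eq_fun do rewrite mul1r.
Qed.

(* The boxes [2i, 2i + 1] keep the coordinates at mutual distance at least 1. *)
Lemma partition_function_gt0 c kappa : 0 < c -> 0 < kappa -> 0 < Z c kappa.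
Proof.
move=> c0 k0.
pose b (i : nat) : set R := `[(2 * i)%:R, (2 * i).+1%:R]%classic.
(* On the boxes the i-th coordinate is at most 2i + 1, so [d] bounds the Gaussian factor from below,
   while the gaps bound the interaction below by 1. *)
pose d := expR (- (c * \sum_(i < N) (2 * i).+1%:R ^+ 2)).
pose f (i : nat) (x : R) : R := \1_(b i) x.
have mf i : measurable_fun setT (f i) by apply: measurable_indic; exact: measurable_itv.
have f0 i x : 0 <= f i x by rewrite /f indicE.
have d0 : 0 < d by exact: expR_gt0.
have le_dW t : d * \prod_(i < N) f i (tnth t i) <= W c kappa t.
  have [/forallP tb'|] := boolP [forall i : 'I_N, tnth t i \in b i]; last first.
    rewrite negb_forall => /existsP[i ti]; rewrite (bigD1 i) //= /f indicE (negbTE ti).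
    by rewrite mul0r mulr0 reg_weight_ge0.
  have tb (i : 'I_N) : (2 * i)%:R <= tnth t i <= (2 * i).+1%:R.
    by have := tb' i; rewrite inE /b /= in_itv.
  rewrite big1 ?mulr1; last first.
    by move=> i _; rewrite /f indicE tb'.
  rewrite /d /reg_weight -[leLHS]mulr1 ler_pM ?expR_ge0 //.
    rewrite ler_expR lerN2 ler_wpM2l ?(ltW c0) //; apply: ler_sum => i _.
    have /andP[t0 t1] := tb i.
    by apply: lerXn2r; rewrite ?nnegrE //; apply: le_trans t0.
  apply: prodr_ge1 => j _; apply: prodr_ge1 => k jk.
  have -> : 1 = 1 `^ kappa :> R by rewrite powR1.
  rewrite addr0; apply: ge0_ler_powR; rewrite ?nnegrE ?(ltW k0) ?sqr_ge0 //.
  have /andP[_ tj] := tb j; have /andP[tk _] := tb k.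
  suff : 1 <= tnth t k - tnth t j by nra.
  rewrite lerBrDl; apply: le_trans tk; apply: (le_trans (lerD tj (lexx 1))).
  by rewrite natr1 ler_nat; lia.
have If : (\int[lebesgue_tuple N]_t (d * \prod_(i < N) f i (tnth t i))%:E = d%:E)%E.
  under eq_integral do rewrite EFinM.
  rewrite ge0_integralZl //=; last 3 first.
  - by apply/measurable_EFinP; exact: measurable_prod_tnth.
  - by move=> t _; rewrite lee_fin prodr_ge0.
  - by rewrite lee_fin ltW.
  rewrite integral_lebesgue_tuple_prod // big1 ?mule1 // => i _.
  rewrite integral_indic //=; last exact: measurable_itv.
  rewrite setIT lebesgue_measure_itv /= lte_fin ltr_nat ltnSn.
  by rewrite -EFinD -natr1 addrAC subrr add0r.
have iW := reg_weight_integrable c0 k0.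
rewrite /Rintegral -lte_fin fineK; last exact: integrable_fin_num.
apply: (@lt_le_trans _ _ d%:E); first by rewrite lte_fin.
rewrite -If; apply: ge0_le_integral => //.
- by move=> t _; rewrite lee_fin mulr_ge0 ?(ltW d0) // prodr_ge0.
- by apply/measurable_EFinP; apply: measurable_funM => //; exact: measurable_prod_tnth.
- by apply/measurable_EFinP; exact: measurable_reg_weight.
- by move=> t _; rewrite lee_fin.
Qed.

Section Linear.
Variables (c kappa : R).
Hypotheses (c0 : 0 < c) (k0 : 0 < kappa).
Local Notation E := (gauss_mean c kappa).

Lemma gauss_meanD f g : admissible f -> admissible g ->
  E (fun t => f t + g t) = E f + E g.
Proof.
move=> af ag; rewrite !gauss_meanE -mulrDl; congr (_ / _).
under eq_Rintegral do rewrite mulrDl.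
by rewrite RintegralD //; exact: admissible_weight_integrable.
Qed.

Lemma gauss_meanZ a f : admissible f -> E (fun t => a * f t) = a * E f.
Proof.
move=> af; rewrite !gauss_meanE mulrA; congr (_ / _).
under eq_Rintegral do rewrite -mulrA.
by rewrite RintegralZl //; exact: admissible_weight_integrable.
Qed.

Lemma gauss_mean1 : E (fun=> 1) = 1.
Proof.
rewrite gauss_meanE; under eq_Rintegral do rewrite mul1r.
by rewrite divff // gt_eqF // partition_function_gt0.
Qed.

Lemma eq_gauss_mean f g : f =1 g -> E f = E g.
Proof. by move=> /funext ->. Qed.

Lemma gauss_mean0 : E (fun=> 0) = 0.
Proof.
rewrite -[RHS](mul0r (E (fun=> 1))) -gauss_meanZ; last exact: admissible_cst.
by apply: eq_gauss_mean => t; rewrite mul0r.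
Qed.

Lemma gauss_mean_sum (I : Type) (r : seq I) (F : I -> T -> R) :
  (forall i, admissible (F i)) ->
  E (fun t => \sum_(i <- r) F i t) = \sum_(i <- r) E (F i).
Proof.
move=> aF; elim: r => [|i r IH].
  by rewrite big_nil -[RHS]gauss_mean0; apply: eq_gauss_mean => t; rewrite big_nil.
rewrite big_cons -IH -gauss_meanD //; last by apply: admissible_sum.
by apply: eq_gauss_mean => t; rewrite big_cons.
Qed.

Lemma admissible_absorb k (G : nat -> seq nat -> T -> R) s :
  (forall x u, admissible (G x u)) ->
  admissible (fun t => absorb k (fun x u => G x u t) s).
Proof.
elim: s G => [|y s IH] G aG /=; first exact: admissible_cst.
apply: admissibleD; first by apply: admissibleM => //; exact: admissible_cst.
exact: (IH (fun x u => G x (y :: u))).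
Qed.

Lemma gauss_mean_absorb k (G : nat -> seq nat -> T -> R) s :
  (forall x u, admissible (G x u)) ->
  E (fun t => absorb k (fun x u => G x u t) s) = absorb k (fun x u => E (G x u)) s.
Proof.
elim: s G => [|y s IH] G aG /=.
  exact: gauss_mean0.
rewrite gauss_meanD ?gauss_meanZ //.
- by rewrite (IH (fun x u => G x (y :: u))).
- by apply: admissibleM => //; exact: admissible_cst.
- exact: (admissible_absorb _ _ (G := fun x u => G x (y :: u))).
Qed.

Definition gauss_moment s : R := E (power_sums s).

Lemma gauss_moment_nil : gauss_moment [::] = 1.
Proof. by rewrite -[RHS]gauss_mean1; apply: eq_gauss_mean => t; rewrite /power_sums big_nil. Qed.

Lemma gauss_moment0 s : gauss_moment (0%N :: s) = N%:R * gauss_moment s.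
Proof.
rewrite -gauss_meanZ; last exact: admissible_power_sums.
apply: eq_gauss_mean => t; rewrite power_sums_cons /power_sum.
by under eq_bigr do rewrite expr0; rewrite sumr_const card_ord.
Qed.

Lemma gauss_moment_perm s s' : perm_eq s s' -> gauss_moment s = gauss_moment s'.
Proof. by move=> ss; apply: eq_gauss_mean => t; exact: perm_big. Qed.

(** In the factor [1 - kappa], the 1 comes from differentiating lambda_j^k and the [- kappa] from
    the diagonal in [pair_sum]. *)
Lemma gauss_moment_loop k s :
  2 * c * gauss_moment (k.+1 :: s) =
  (1 - kappa) * k%:R * gauss_moment (k.-1 :: s) +
  \sum_(i < k) kappa * gauss_moment [:: (k.-1 - i)%N, (i : nat) & s] +
  absorb k (fun x => deriv_head x gauss_moment) s.
Proof.
have aP u := @admissible_power_sums R N u.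
have aZ a u : admissible (fun t : T => a * power_sums u t).
  by apply: admissibleM => //; exact: admissible_cst.
have aA : admissible (fun t : T => absorb k (fun x u => power_sums (x :: u) t) s).
  exact: (admissible_absorb _ _ (G := fun x u => power_sums (x :: u))).
have aS : admissible (fun t : T => \sum_(i < k) kappa * power_sums [:: (k.-1 - i)%N, (i : nat) & s] t).
  by apply: admissible_sum => i _.
apply/eqP; rewrite -subr_eq0; apply/eqP.
transitivity (- E (fun t => ((1 - kappa) * k%:R) * power_sums (k.-1 :: s) t +
   \sum_(i < k) kappa * power_sums [:: (k.-1 - i)%N, (i : nat) & s] t +
   absorb k (fun x u => power_sums (x :: u) t) s + (- (2 * c)) * power_sums (k.+1 :: s) t)).
  rewrite gauss_meanD //; last by apply: admissibleD => //; apply: admissibleD.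
  rewrite gauss_meanD //; last by apply: admissibleD.
  rewrite gauss_meanD // gauss_mean_sum // (gauss_mean_absorb _ _ (G := fun x u => power_sums (x :: u))) //.
  rewrite !gauss_meanZ // /gauss_moment.
  under [X in _ = - (_ + X + _ + _)]eq_bigr do rewrite gauss_meanZ //.
  rewrite /deriv_head; ring.
apply/eqP; rewrite oppr_eq0 gauss_meanE mulf_eq0; apply/orP; left.
rewrite /Rintegral [X in fine X](_ : _ = 0%E) // -[RHS](@integral_loop R N k s _ _ c0 k0).
apply: eq_integral => t _; congr (_ * _)%:E; rewrite /loop_core.
have := sum_dpower_sums k s t 1; rewrite mul1r => ->.
have -> : absorb k (fun x u => 1 * power_sums (x :: u) t) s =
    absorb k (fun x u => power_sums (x :: u) t) s.
  by apply: eq_absorb => x u _; rewrite mul1r.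
have -> : \sum_(i < k) kappa * power_sums [:: (k.-1 - i)%N, (i : nat) & s] t =
    kappa * power_sums s t * \sum_(i < k) power_sum (k.-1 - i) t * power_sum i t.
  by rewrite mulr_sumr; apply: eq_bigr => i _; rewrite !power_sums_cons; ring.
by rewrite !power_sums_cons; ring.
Qed.

End Linear.
End GaussianMean.

(** * Limits and duality *)

Section Limits.
Context {R : realType}.
Implicit Types (c kappa alpha : R).

Definition gauss_cumulant N c kappa : seq nat -> R :=
  seq_cumulant (@gauss_moment R N c kappa).

Lemma mixed_cumulant_gauss c kappa N n (p : 'I_n -> nat) :
  mixed_cumulant (fun x => expR (- (c * x ^+ 2))) kappa N p =
  gauss_cumulant N c kappa [seq p i | i <- enum 'I_n].
Proof.
rewrite /gauss_cumulant.
have <- := set_cumulant_uniq (@gauss_moment_perm R N c kappa) p (enum_uniq 'I_n).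
have -> : finset.finset (fun x => x \in enum 'I_n) = finset.setTfor 'I_n.
  by apply/finset.setP => i; rewrite finset.in_set finset.in_setT mem_enum.
rewrite /mixed_cumulant /joint_cumulant /set_cumulant; apply: eq_bigr => P _.
congr (_ * _); apply: eq_bigr => B _.
rewrite /set_moment /gauss_moment; congr gauss_mean; apply/funext => t.
by rewrite /power_sums big_map big_enum.
Qed.

Lemma gauss_cumulant_loop N c kappa : 0 < c -> 0 < kappa ->
  solves_loop ((1 - kappa) / (2 * c)) (kappa / (2 * c)) (kappa / (2 * c))
    (2 * c)^-1 N%:R (gauss_cumulant N c kappa).
Proof.
move=> c0 k0; have c2 : 2 * c != 0 by rewrite mulf_neq0 ?pnatr_eq0 // gt_eqF.
apply: (@cumulant_loop _ _ _ _ _ (@gauss_moment R N c kappa)).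
- exact: gauss_moment_nil.
- exact: gauss_moment0.
- move=> k s; apply: (mulfI c2); rewrite gauss_moment_loop // !mulrDr.
  congr (_ + _ + _).
  + by field; rewrite gt_eqF.
  + by rewrite mulr_sumr; apply: eq_bigr => i _; field; rewrite gt_eqF.
  + by rewrite mulrA divff // mul1r.
- move=> x; apply: seq_cumulant_rec; first exact: gauss_moment_perm.
  exact: gauss_moment_nil.
Qed.

(** These are the coefficients of [gauss_cumulant_loop] at [c = kappa] after [loop_scale] with sigma
    = 1/kappa, rho = kappa, which produces the normalization kappa^(n-1); 'X stands for 1/kappa. *)
Definition low_temp_poly (N : nat) : seq nat -> {poly R} :=
  loop_sol (2^-1 *: ('X - 1)) (2^-1 *: 'X) (2^-1)%:P (2^-1)%:P (N%:R)%:P.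

Lemma low_temp_poly_eval N (x : R) :
  solves_loop (2^-1 * (x - 1)) (2^-1 * x) 2^-1 2^-1 N%:R
    (fun s => (low_temp_poly N s).[x]).
Proof.
have := rmorph_solves_loop (horner_eval x) (@loop_sol_solves _ (2^-1 *: ('X - 1))
  (2^-1 *: 'X) (2^-1)%:P (2^-1)%:P (N%:R : R)%:P).
by rewrite /= /horner_eval !(hornerE, hornerZ, hornerC).
Qed.

Lemma low_temp_cumulant N kappa x s : 0 < kappa ->
  kappa ^+ size s * gauss_cumulant N kappa kappa (x :: s) =
  (low_temp_poly N (x :: s)).[kappa^-1].
Proof.
move=> k0; have kn0 : kappa != 0 by rewrite gt_eqF.
have E1 : kappa / (2 * kappa) = kappa * (2^-1 * kappa^-1) by field.
have E2 : kappa / (2 * kappa) = kappa^-1 * kappa * 2^-1 by field.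
have := loop_scale 1 E1 E2 (gauss_cumulant_loop N k0 k0).
rewrite !expr1n !mul1r mulr1 mulVf // mul1r.
rewrite (_ : (1 - kappa) / (2 * kappa) = 2^-1 * (kappa^-1 - 1)); last by field.
rewrite (_ : kappa * (2 * kappa)^-1 = 2^-1); last by field.
move=> /loop_unique /(_ (low_temp_poly_eval N kappa^-1)) <-.
by rewrite expr1n mulr1 /= exprS mulrA mulVf // mul1r.
Qed.

Lemma mu0G_low_temp n N (p : 'I_n -> nat) : (0 < n)%N ->
  mu0G N p = (low_temp_poly N [seq p i | i <- enum 'I_n]).[0] :> R.
Proof.
move=> n0; rewrite /mu0G; apply/cvg_lim => //.
set s := map p (enum 'I_n).
have sn : size s = n by rewrite size_map size_enum_ord.
have cV : (fun kappa : R => (low_temp_poly N s).[kappa^-1]) @ +oo --> (low_temp_poly N s).[0].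
  apply: (@cvg_comp _ _ _ (@GRing.inv R) (horner (low_temp_poly N s)) _ (nbhs (0 : R))).
    apply/cvgr0Pnorm_lt => e e0; near=> kappa.
    have ke : e^-1 < kappa by near: kappa; apply: nbhs_pinfty_gt; rewrite num_real.
    have k0 : 0 < kappa by rewrite (lt_trans _ ke) // invr_gt0.
    by rewrite gtr0_norm ?invr_gt0 // -[ltRHS]invrK ltf_pV2 // posrE ?invr_gt0.
  exact: continuous_horner.
apply: cvg_trans cV; apply: near_eq_cvg; near=> kappa.
have k0 : 0 < kappa by near: kappa; exact: nbhs_pinfty_gt.
rewrite (_ : (fun x => expR (- kappa * x ^+ 2)) = (fun x => expR (- (kappa * x ^+ 2)))); last first.
  by apply/funext => x; rewrite mulNr.
rewrite mixed_cumulant_gauss -/s.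
case: s sn => [|x s] sn; first by rewrite -sn in n0.
by rewrite -sn -low_temp_cumulant.
Unshelve. all: by end_near.
Qed.

(** Here c = 1/2, kappa = alpha/N, and [loop_scale] is used with sigma = 1/N, rho = 1; 'X stands for
    1/N. *)
Definition high_temp_poly alpha : seq nat -> {poly R} :=
  loop_sol (1 - alpha *: 'X) (alpha *: 'X) alpha%:P 1 1.

Lemma high_temp_poly_eval alpha (x : R) :
  solves_loop (1 - alpha * x) (alpha * x) alpha 1 1
    (fun s => (high_temp_poly alpha s).[x]).
Proof.
have := rmorph_solves_loop (horner_eval x) (@loop_sol_solves _ (1 - alpha *: 'X)
  (alpha *: 'X) alpha%:P 1 1).
by rewrite /= /horner_eval !(hornerE, hornerZ, hornerC).
Qed.

Lemma high_temp_cumulant N alpha x s : (0 < N)%N -> 0 < alpha ->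
  N%:R^-1 * gauss_cumulant N 2^-1 (alpha / N%:R) (x :: s) =
  (high_temp_poly alpha (x :: s)).[N%:R^-1].
Proof.
move=> N0 a0; have Nn0 : (N%:R : R) != 0 by rewrite pnatr_eq0 -lt0n.
have h0 : 0 < 2^-1 :> R by [].
have k0 : 0 < alpha / N%:R by rewrite divr_gt0 ?ltr0n.
have E1 : alpha / N%:R / (2 * 2^-1) = 1 * (alpha / N%:R) by field.
have E2 : alpha / N%:R / (2 * 2^-1) = N%:R^-1 * 1 * alpha by field.
have := loop_scale 1 E1 E2 (gauss_cumulant_loop N h0 k0).
rewrite !expr1n !mul1r mulr1 (mulVf Nn0) divff ?pnatr_eq0 // invr1 !mulr1.
move=> /loop_unique /(_ (high_temp_poly_eval alpha N%:R^-1)) <-.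
by rewrite !expr1n !mulr1.
Qed.

(** The indeterminate is now alpha: with 1/N set to 0, the recursion has coefficients polynomial in
    alpha, which gives the extension to negative values. *)
Definition high_temp_limit : seq nat -> {poly R} := loop_sol 1 0 'X 1 1.

Lemma high_temp_limit_eval alpha :
  solves_loop 1 0 alpha 1 1 (fun s => (high_temp_limit s).[alpha]).
Proof.
have := rmorph_solves_loop (horner_eval alpha) (@loop_sol_solves _ 1 0 'X 1 1).
by rewrite /= /horner_eval !(hornerE, hornerC).
Qed.

Lemma high_temp_poly0 alpha x s :
  (high_temp_poly alpha (x :: s)).[0] = (high_temp_limit (x :: s)).[alpha].
Proof.
have := high_temp_poly_eval alpha 0; rewrite mulr0 subr0 => h0.
exact: loop_unique h0 (high_temp_limit_eval alpha) x s.
Qed.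

Lemma mixed_cumulant_high_temp n (p : 'I_n -> nat) alpha : (0 < n)%N -> 0 < alpha ->
  N%:R^-1 * mixed_cumulant (fun x => expR (- x ^+ 2 / 2)) (alpha / N%:R) N p
    @[N --> \oo] --> (high_temp_limit [seq p i | i <- enum 'I_n]).[alpha].
Proof.
move=> n0 a0; set s := map p (enum 'I_n).
have sn : size s = n by rewrite size_map size_enum_ord.
have w2 : (fun x : R => expR (- x ^+ 2 / 2)) = (fun x => expR (- (2^-1 * x ^+ 2))).
  by apply/funext => x; rewrite mulNr mulrC.
have ->: (high_temp_limit s).[alpha] = (high_temp_poly alpha s).[0].
  by case: s sn => [|x s] sn; [rewrite -sn in n0|rewrite high_temp_poly0].
have cV : (high_temp_poly alpha s).[N%:R^-1] @[N --> \oo] --> (high_temp_poly alpha s).[0].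
  apply: (@cvg_comp _ _ _ (fun N : nat => N%:R^-1 : R) (horner (high_temp_poly alpha s))
    _ (nbhs (0 : R))).
    by rewrite -cvg_shiftS; exact: cvg_harmonic.
  exact: continuous_horner.
apply: cvg_trans cV; apply: near_eq_cvg; near=> N.
have N0 : (0 < N)%N by near: N; exact: nbhs_infty_gt.
rewrite w2 mixed_cumulant_gauss -/s.
case: s sn => [|x s] sn; first by rewrite -sn in n0.
by rewrite -high_temp_cumulant.
Unshelve. all: by end_near.
Qed.

Lemma poly_eq_pos (P Q : {poly R}) : (forall x, 0 < x -> P.[x] = Q.[x]) -> P = Q.
Proof.
move=> PQ; apply/eqP; rewrite -subr_eq0; apply/eqP.
(* The difference vanishes at the positive integers, and as many of them as its size are too many
   roots. *)
apply: (@roots_geq_poly_eq0 _ _ [seq i.+1%:R | i <- iota 0 (size (P - Q))]).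
- by apply/allP => _ /mapP[i _ ->]; rewrite /root hornerD hornerN PQ ?ltr0n // subrr.
- rewrite map_inj_uniq ?iota_uniq // => i j /eqP.
  by rewrite eqr_nat => /eqP[].
- by rewrite size_map size_iota.
Qed.

Lemma mu0Gs_high_temp n (p : 'I_n -> nat) : (0 < n)%N ->
  @mu0Gs R n p = high_temp_limit [seq p i | i <- enum 'I_n].
Proof.
move=> n0; rewrite /mu0Gs; apply: xget_unique.
  by move=> alpha a0; exact: mixed_cumulant_high_temp.
move=> Q hQ; apply: poly_eq_pos => alpha a0.
have := @mixed_cumulant_high_temp n p alpha n0 a0; have := hQ _ a0.
by move=> /(cvg_lim (@norm_hausdorff _ _)) <- /(cvg_lim (@norm_hausdorff _ _)) <-.
Qed.

End Limits.

(** * Matching the two limiting recursions *)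

Section Duality.
Local Open Scope complex_scope.

(** The coefficients (u, v, w, r, nu) are (-1/2, 0, 1/2, 1/2, N) at low temperature and (1, 0,
    alpha, 1, 1) at high temperature. Under [loop_scale], u forces t^2 = -2, then r forces rho = -1,
    and nu forces sigma = -1/N; w becomes t^2 / (2 sigma rho) = -N, so the match holds exactly at
    alpha = -N. *)
Lemma high_low_temp_duality (R : realType) (N x : nat) (s : seq nat) : (0 < N)%N ->
  (-1) ^+ (size s).+2 * ((- 'i%C * (Num.sqrt 2)%:C) ^+ (sumn (x :: s)) / N%:R) *
    ((low_temp_poly N (x :: s)).[0] : R)%:C =
  ((high_temp_limit (x :: s)).[- N%:R] : R)%:C.
Proof.
move=> N0; set t := - 'i%C * _.
have Nn0 : (N%:R : R[i]) != 0 by rewrite pnatr_eq0 -lt0n.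
have t2 : t ^+ 2 = - 2.
  rewrite exprMn sqrrN sqr_i -rmorphXn /= sqr_sqrtr // mulN1r.
  by rewrite rmorphMn.
have hL := rmorph_solves_loop (@real_complex R) (low_temp_poly_eval N 0).
have hH := rmorph_solves_loop (@real_complex R) (high_temp_limit_eval (- N%:R : R)).
have E1 : (2^-1 * 0 : R)%:C = -1 * 0 by rewrite !mulr0.
have E2 : (2^-1 : R)%:C = - N%:R^-1 * -1 * (N%:R / 2).
  rewrite mulrN1 opprK mulrA mulVf // mul1r fmorphV; congr _^-1.
  by rewrite rmorphMn.
have := loop_scale t E1 E2 hL.
have c2 : (2^-1 : R)%:C = 2^-1 :> R[i] by rewrite fmorphV rmorphMn.
have cN : (N%:R : R)%:C = N%:R :> R[i] by rewrite rmorph_nat.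
have n2 : (2 : R[i]) != 0 by rewrite pnatr_eq0.
rewrite t2 mulr0.
have -> : - 2 * (2^-1 * (0 - 1) : R)%:C = (1 : R)%:C :> R[i].
  by rewrite sub0r mulrN1 rmorphN /= c2 mulrNN divff.
have -> : - 2 * (N%:R / 2) = (- N%:R : R)%:C :> R[i].
  by rewrite rmorphN /= cN; field.
have -> : -1 * - 2 * (2^-1 : R)%:C = (1 : R)%:C :> R[i].
  by rewrite c2 mulN1r opprK divff.
have -> : - N%:R^-1 * -1 * (N%:R : R)%:C = (1 : R)%:C :> R[i].
  by rewrite cN mulrN1 opprK mulVf.
rewrite rmorph0 in hH.
move=> /loop_unique /(_ hH x s) /= <-.
rewrite !exprS; ring.
Qed.

End Duality.

Local Open Scope complex_scope.

Theorem corollary2p5 (R : realType) (n N : nat) (n_gt0 : (0 < n)%N) (N_gt0 : (0 < N)%N) :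
  series_scale (- (- 'i%C / (Num.sqrt 2)%:C) ^+ n * N%:R^-1)
      (series_dilate ('i%C / (Num.sqrt 2)%:C) (@W0G R n N))
    = @W0Gs R n (- N%:R)
  /\
  (forall p : 'I_n -> nat,
    (-1) ^+ n.+1 * ((- 'i%C * (Num.sqrt 2)%:C) ^+ (\sum_j p j)%N / N%:R) * (@mu0G R n N p)%:C
      = ((@mu0Gs R n p).[- N%:R])%:C).
Proof.
have coef (p : 'I_n -> nat) :
    (-1) ^+ n.+1 * ((- 'i%C * (Num.sqrt 2)%:C) ^+ (\sum_j p j)%N / N%:R) * (@mu0G R n N p)%:C
      = ((@mu0Gs R n p).[- N%:R])%:C.
  rewrite mu0G_low_temp // mu0Gs_high_temp //.
  have -> : (\sum_j p j)%N = sumn [seq p i | i <- enum 'I_n].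
    by rewrite sumnE big_map big_enum.
  have : size [seq p i | i <- enum 'I_n] = n by rewrite size_map size_enum_ord.
  case: [seq p i | i <- enum 'I_n] => [|x s] sn; first by rewrite -sn in n_gt0.
  by rewrite -sn high_low_temp_duality.
split=> //; apply/funext => e.
rewrite /series_scale /series_dilate /W0G /W0Gs /npoint_series.
case: ifP => [/forallP e0|_]; last by rewrite !mulr0.
rewrite -coef [LHS]mulrA; congr (_ * _).
set p := fun j => absz (e j + 1).
(* The extra [n] comes from the prefactor 1/(x_1 ... x_n). *)
have pE : \sum_j e j = - (\sum_j p j + n)%N%:Z.
  have ej j : e j = - ((p j)%:Z + 1).
    by rewrite /p abszE ler0_norm; have := e0 j; lia.
  rewrite (eq_bigr _ (fun j _ => ej j)) sumrN big_split /= sumr_const card_ord.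
  by rewrite PoszD (big_morph Posz PoszD (erefl _)) natz.
set q : R[i] := (Num.sqrt 2)%:C.
have q0 : q != 0 by rewrite fmorph_eq0 sqrtr_eq0 -ltNge.
have qV : ('i%C / q)^-1 = - 'i%C * q by rewrite invf_div mulrC invCi.
rewrite pE -exprnN -exprVn qV exprD.
(* The [n] surplus factors of the dilation meet the scalar prefactor and leave only a sign. *)
have qn : (- 'i%C / q) ^+ n * (- 'i%C * q) ^+ n = (-1) ^+ n.
  by rewrite -exprMn mulrACA mulrNN -expr2 sqr_i mulVf // mulr1.
rewrite exprS -qn; ring.
Qed.
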